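(* Let $d,k,s \in \mathbb{Z}$ be such that $k \geq 3$, $1 \leq d \leq k-1$, and $0 \leq s \leq k-1$. For every $\gamma > 0$, there exist $C>0$ and $n_0 \in \mathbb{N}$ such that the following holds for all $n \in k\mathbb{N} + s$ with $n \geq n_0$. For every $k$-uniform $n$-vertex hypergraph $\mathcal{H}$ with $\delta_{d}(\mathcal{H}) \geq \left(\overline{\mu_d}^{(s)}(k) + \gamma\right) \binom{n-d}{k-d}$, there exists a probability measure on the set of optimal matchings in $\mathcal{H}$ which is $(C/n^{k-1})$-spread.
   Context: A $k$-uniform hypergraph $\mathcal{H}$ consists of a finite vertex set $V(\mathcal{H})$ and a set of edges, each a $k$-element subset of $V(\mathcal{H})$; $\mathcal{H}$ is identified with its edge set. A matching is a set of pairwise disjoint edges. An optimal matching of a $k$-uniform hypergraph $\mathcal{H}$ is a matching with exactly $\lfloor |V(\mathcal{H})|/k \rfloor$ edges. The minimum $d$-degree $\delta_d(\mathcal{H})$ is the minimum, over all sets $S$ of $d$ distinct vertices, of the number of edges containing $S$. For $n \geq k > d \geq 1$, $m_d(k,n)$ is the minimum integer $D \geq 0$ such that every $k$-uniform $n$-vertex hypergraph $\mathcal{H}$ with $\delta_d(\mathcal{H}) \geq D$ has an optimal matching. For $s \in \{0,\dots,k-1\}$, $$\overline{\mu_d}^{(s)}(k) := \limsup_{n \to \infty,\; n \equiv s \ (\mathrm{mod}\ k)} \frac{m_d(k,n)}{\binom{n-d}{k-d}}.$$ Spreadness: for $q \in [0,1]$, a probability measure $\nu$ on a set of matchings of $\mathcal{H}$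 is $q$-spread if, for $M$ chosen at random according to $\nu$, for each $t \geq 1$ and distinct $e_1,\dots,e_t \in \mathcal{H}$ we have $\mathbb{P}[e_1,\dots,e_t \in M] \leq q^t$. *)

(* Defs.v *)
From mathcomp Require Export all_boot all_order all_algebra.
From mathcomp Require Export reals sequences.

Set Implicit Arguments.
Unset Strict Implicit.
Unset Printing Implicit Defensive.

Import Order.TTheory GRing.Theory Num.Theory.

Section Hypergraphs.
Variable V : finType.
Implicit Types (H M E : {set {set V}}) (S e : {set V}).

(* A hypergraph on the vertex set V is identified with its set of edges. *)
Definition uniform (k : nat) H : bool := [forall e in H, #|e| == k].

Definition degree H S : nat := #|[set e in H | S \subset e]|.

(* All degrees are at most #|H|, so this is the genuine minimum as soon as V
   has a d-element subset, i.e. d <= #|V|. *)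
Definition min_degree (d : nat) H : nat :=
  \big[minn/#|H|]_(S : {set V} | #|S| == d) degree H S.

Definition matching H M : bool := (M \subset H) && trivIset M.

Definition optimal_matching (k : nat) H M : bool :=
  matching H M && (#|M| == #|V| %/ k).

Definition optimal_matchings (k : nat) H : {set {set {set V}}} :=
  [set M | optimal_matching k H M].

End Hypergraphs.

Definition forces_optimal_matching (d k n D : nat) : bool :=
  [forall H : {set {set 'I_n}},
    (uniform k H && (D <= min_degree d H)) ==>
    [exists M, optimal_matching k H M]].

Lemma min_degree_le_card (V : finType) (d : nat) (H : {set {set V}}) :
  min_degree d H <= #|H|.
Proof.
rewrite /min_degree; elim/big_ind: _ => [//|x y xH _|S _].
  exact: leq_trans (geq_minl x y) xH.
by apply/subset_leq_card/subsetP => e; rewrite inE => /andP[].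
Qed.

Lemma forces_optimal_matching_ex (d k n : nat) :
  exists D, forces_optimal_matching d k n D.
Proof.
exists #|{set 'I_n}|.+1; apply/forallP => H; apply/implyP => /andP[_ DH].
by have := leq_trans DH (leq_trans (min_degree_le_card d H) (max_card (mem H)));
  rewrite ltnn.
Qed.

(* m_d(k, n); meaningful for 1 <= d < k <= n. *)
Definition optimal_threshold (d k n : nat) : nat :=
  ex_minn (forces_optimal_matching_ex d k n).

Local Open Scope ring_scope.

(* m_d(k, n) / binom(n - d, k - d) along n = s, k + s, 2k + s, ...  For
   1 <= d < k and s < k this real sequence is bounded: the term j = 0 (where
   s < k) has a zero denominator, hence is 0 by the convention x / 0 = 0, and
   for n >= k every minimum d-degree is at most binom(n - d, k - d), so
   m_d(k, n) <= binom(n - d, k - d) + 1.  So limn_sup is the limsup. *)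
Definition threshold_ratio (R : realType) (d k s : nat) : R^nat :=
  fun j => let n := (k * j + s)%N in
    (optimal_threshold d k n)%:R / 'C(n - d, k - d)%:R.

Definition mu_bar (R : realType) (d k s : nat) : R :=
  limn_sup (threshold_ratio R d k s).

Section FiniteProbability.
Variables (R : realType) (T : finType).

(* A probability measure on the finite set A, given by its mass function
   extended by 0 outside A. *)
Definition probability_on (A : {set T}) (nu : T -> R) : Prop :=
  [/\ forall x, 0 <= nu x,
      forall x, x \notin A -> nu x = 0
    & \sum_(x in A) nu x = 1].

Definition prob (nu : T -> R) (P : pred T) : R := \sum_(x | P x) nu x.

End FiniteProbability.

(* The t distinct edges e_1, ..., e_t are given as a t-element set E. *)
Definition spread (R : realType) (V : finType) (H : {set {set V}})
    (nu : {set {set V}} -> R) (q : R) : Prop :=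
  0 <= q <= 1 /\
  forall (t : nat) (E : {set {set V}}),
    (1 <= t)%N -> E \subset H -> #|E| = t ->
    prob nu (fun M => E \subset M) <= q ^+ t.

(* Main.v *)
Require Import Defs.
From mathcomp Require Import all_fingroup zify ring lra exp.
From mathcomp Require classical_sets normedtype.
Set Implicit Arguments.
Unset Strict Implicit.
Unset Printing Implicit Defensive.
Import Order.TTheory GRing.Theory Num.Theory.

(** Place the vertices at random in n positions and cut the positions into
    consecutive blocks whose sizes lie between m and 2m, for a large constant m.
    A window is a block together with its predecessor; it is good if every d-set in
    it has at least the expected density of extensions into the block.

    If all windows are good, an optimal matching is built deterministically along
    the chain of blocks: the fewer than k + s vertices left over by one block are
    covered greedily using the next block, fewer than k vertices are set aside to
    make the size of the rest congruent to s modulo k, and the definition of m_d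
    yields an optimal matching of the rest. Every edge of the result lies in a window,
    so t disjoint edges can occupy only O(n)^t lists of kt positions.

    A single window is bad with probability exponentially small in m (compare with
    independent sampling and use bounded differences), so the lopsided local lemma
    for random permutations applies: all windows are good with positive probability,
    and conditioning on this event multiplies the probability that given vertices
    occupy given positions by at most a constant per vertex. Hence t given disjoint
    edges appear with probability at most (C n / n^k)^t. *)

(** * The local lemma for random permutations *)

Lemma sum_has_le (I : eqType) (r : seq I) (T : Type) (h : I -> T -> bool) (f : I -> nat) (ts : seq T) :
  \sum_(i <- r | has (h i) ts) f i <= \sum_(t <- ts) \sum_(i <- r | h i t) f i.
Proof.
elim: ts => [|t ts IH]; first by rewrite big_nil big_pred0.
rewrite big_cons; apply: leq_trans (leq_add (leqnn _) IH).
rewrite !(big_mkcond (fun i => h i t)) !(big_mkcond (fun i => has (h i) _)) -big_split /=.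
by apply: leq_sum => i _; case: (h i t) => //=; rewrite leq_addr.
Qed.

Lemma sum_filter_le (I : eqType) (r s : seq I) (P : pred I) (f : I -> nat) :
  subseq s r -> \sum_(i <- s | P i) f i <= \sum_(i <- r | P i) f i.
Proof.
elim: r s => [|y r IH] [|x s] //=; first by rewrite big_nil.
rewrite !big_cons; case: eqVneq => [->|_] /IH h.
  by case: ifP => // _; rewrite leq_add2l.
rewrite big_cons in h; apply: leq_trans h _; case: ifP => // _; exact: leq_addl.
Qed.

Section LocalLemma.
Variable V : finType.
Implicit Types (ps vs : seq V) (B : seq V * seq V) (F : seq (seq V * seq V)).
Implicit Types (p : {perm V}) (z : V + V).

(* An event is a pair B = (ps, vs): the permutation maps the list ps to the list vs.
   The points of an event are its positions, tagged inl, and its values, tagged inr. *)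
Definition extends ps vs : {set {perm V}} :=
  [set p : {perm V} | [seq p x | x <- ps] == vs].

Definition avoids F : {set {perm V}} :=
  [set p : {perm V} | ~~ has (fun B => p \in extends B.1 B.2) F].

Definition hits B z : bool :=
  match z with inl x => x \in B.1 | inr v => v \in B.2 end.

Definition points B : seq (V + V) := map inl B.1 ++ map inr B.2.

(* Exchanging the values v and w maps the left-hand set injectively into the
   right-hand one: a permutation agreeing with some B in F only after the exchange
   would show that B mentions x or v. *)
Lemma swap_le F ps vs x v w :
  v \notin vs -> w \notin vs ->
  all (fun B => ~~ hits B (inl x) && ~~ hits B (inr v)) F ->
  #|extends (x :: ps) (v :: vs) :&: avoids F| <=
  #|extends (x :: ps) (w :: vs) :&: avoids F|.
Proof.
move=> vvs wvs /allP nF.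
rewrite -(card_imset _ (mulIg (tperm v w))).
apply/subset_leq_card/subsetP => _ /imsetP[p + ->].
rewrite !inE => /andP[/eqP[pxv pvs] avp]; apply/andP; split.
  rewrite /= permM pxv tpermL -pvs; apply/eqP; congr (_ :: _).
  apply/eq_in_map => y yps; rewrite permM tpermD //.
    by apply: contraNneq vvs => ->; rewrite -pvs map_f.
  by apply: contraNneq wvs => ->; rewrite -pvs map_f.
apply: contra avp => /hasP[B BF]; rewrite inE => /eqP pB.
apply/hasP; exists B => //; rewrite inE -[X in _ == X]pB; apply/eqP/eq_in_map => y yB.
rewrite permM; case: tpermP => // pyE.
  move: (nF _ BF) => /andP[/negP[]]; rewrite /hits.
  by move: pxv; rewrite -pyE => /perm_inj ->.
move: (nF _ BF) => /andP[_ /negP[]]; rewrite /hits -pB.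
by apply/mapP; exists y; rewrite // permM pyE tpermR.
Qed.

Lemma card_extends_cons F ps vs x :
  #|extends ps vs :&: avoids F| =
  \sum_w #|extends (x :: ps) (w :: vs) :&: avoids F|.
Proof.
rewrite -sum1_card (partition_big (fun p : {perm V} => p x) xpredT) //=.
apply: eq_bigr => w _; rewrite -sum1_card; apply: eq_bigl => p.
rewrite !inE /= eqseq_cons andbC; by rewrite !andbA.
Qed.

Lemma extends_uniq ps vs p : uniq ps -> p \in extends ps vs -> uniq vs.
Proof. by move=> ups; rewrite inE => /eqP <-; rewrite map_inj_uniq //; apply: perm_inj. Qed.

(** Positions are added one at a time. By [swap_le] the prescribed value [v] is the least likely of
    the [#|V| - size vs] values outside [vs]. *)
Lemma extends_avoids_le F ps vs :
  uniq ps -> uniq vs -> size ps = size vs ->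
  all (fun B => ~~ has (hits B) (points (ps, vs))) F ->
  #|extends ps vs :&: avoids F| * #|V| ^_ (size ps) <= #|avoids F|.
Proof.
elim: ps vs => [|x ps IH] [|v vs] //=.
  by move=> *; rewrite ffactn0 muln1 subset_leq_card // subsetIr.
move=> /andP[xps ups] /andP[vvs uvs] [szE] /allP nF.
apply: leq_trans (IH vs ups uvs szE _); last first.
  apply/allP => B BF; have /= := nF B BF; apply: contra => /hasP[z zp hz].
  apply/orP; right; rewrite has_cat /=; move: zp; rewrite mem_cat => /orP[] zp.
    by apply/orP; left; apply/hasP; exists z.
  by rewrite orbCA; apply/orP; right; apply/orP; right; apply/hasP; exists z.
rewrite ffactnSr mulnA mulnAC leq_mul2r; apply/orP; right.
rewrite (card_extends_cons F ps vs x).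
apply: (@leq_trans (\sum_(w in [set w | w \notin vs]) #|extends (x :: ps) (v :: vs) :&: avoids F|)).
  rewrite sum_nat_const mulnC leq_mul2r; apply/orP; right.
  rewrite szE -(card_uniqP uvs) -(cardC (mem vs)) addKn.
  by apply: subset_leq_card; apply/subsetP => w; rewrite !inE.
rewrite [X in _ <= X](bigID [in [set w | w \notin vs]]) /=.
apply: leq_trans (leq_addr _ _); apply: leq_sum => w; rewrite inE => wvs.
apply: swap_le => //; apply/allP => B /nF.
rewrite has_cat /= negb_or => /andP[].
by rewrite /= !negb_or => -> /andP[_] /andP[->].
Qed.

Lemma avoids_nil : avoids [::] = setT.
Proof. by apply/setP => p; rewrite !inE. Qed.

Lemma card_permT : #|[set: {perm V}]| = #|V|`!.
Proof.
have := card_perm [set: V]; rewrite cardsT => <-.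
by apply: eq_card => p; rewrite !inE; apply/esym/subsetP => x _; rewrite inE.
Qed.

(** With nothing to avoid, [swap_le] works in both directions, so all values outside [vs] are
    equally likely at the next position. *)
Lemma card_extends ps vs :
  uniq ps -> uniq vs -> size ps = size vs ->
  #|extends ps vs| * #|V| ^_ (size ps) = #|V|`!.
Proof.
have E A : A :&: avoids [::] = A by rewrite avoids_nil setIT.
elim: ps vs => [|x ps IH] [|v vs] //=.
  move=> _ _ _; rewrite ffactn0 muln1 -card_permT.
  by apply: eq_card => p; rewrite !inE.
move=> /andP[xps ups] /andP[vvs uvs] [szE].
rewrite -(IH vs ups uvs szE) ffactnSr mulnA mulnAC; congr (_ * _).
rewrite -[extends ps vs]E (card_extends_cons _ ps vs x).
rewrite (bigID [in [set w | w \notin vs]]) /= [X in _ + X]big1 ?addn0; last first.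
  move=> w; rewrite inE negbK => wvs; rewrite E; apply: eq_card0 => p.
  rewrite inE /= eqseq_cons; apply/negP => /andP[/eqP pw /eqP pvs].
  move: wvs; rewrite -pvs -pw mem_map ?(negPf xps) //; exact: perm_inj.
rewrite (eq_bigr (fun=> #|extends (x :: ps) (v :: vs)|)); last first.
  move=> w; rewrite inE => wvs.
  by apply/eqP; rewrite eqn_leq -[extends (x :: ps) (v :: vs)]E !swap_le.
rewrite sum_nat_const mulnC; congr (_ * _).
rewrite szE -(card_uniqP uvs) -(cardC (mem vs)) addKn.
by apply: eq_card => w; rewrite !inE.
Qed.

Lemma avoids_cat F1 F2 : avoids (F1 ++ F2) = avoids F1 :&: avoids F2.
Proof. by apply/setP => p; rewrite !inE has_cat negb_or. Qed.

Lemma avoids_perm F1 F2 : perm_eq F1 F2 -> avoids F1 = avoids F2.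
Proof.
move=> E; apply/setP => p; rewrite !inE; congr (~~ _).
exact: (perm_has _ E).
Qed.

Lemma avoids_union_bound F1 F2 :
  #|avoids F2| <= #|avoids (F1 ++ F2)| +
    \sum_(B <- F1) #|extends B.1 B.2 :&: avoids F2|.
Proof.
elim: F1 => [|B F1 IH]; first by rewrite big_nil addn0.
apply: leq_trans IH _; rewrite big_cons /=.
have -> : avoids (B :: F1 ++ F2) = avoids (F1 ++ F2) :\: extends B.1 B.2.
  by apply/setP => p; rewrite !inE /= inE negb_or.
rewrite -(cardsID (extends B.1 B.2) (avoids (F1 ++ F2))).
suff : #|avoids (F1 ++ F2) :&: extends B.1 B.2| <= #|extends B.1 B.2 :&: avoids F2|.
  by rewrite addnA leq_add2r addnC leq_add2l.
by rewrite setIC avoids_cat setIA subset_leq_card // setISS // subsetIl.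
Qed.

Variables (F : seq (seq V * seq V)) (l : nat).
Hypothesis uniqF : forall B, B \in F -> uniq B.1.
Hypothesis sizeF1 : forall B, B \in F -> size B.1 = size B.2.
Hypothesis sizeF : forall B, B \in F -> size B.1 <= l.
Hypothesis l_gt0 : 0 < l.
(** The events through one point have total probability at most [1/(8l)]. An event has at most [2l]
    points, so the events sharing a point with it have total probability at most 1/4. *)
Hypothesis sparseF : forall z,
  8 * l * (\sum_(B <- F | hits B z) #|extends B.1 B.2|) <= #|V|`!.

(** Union bound under conditioning: given [avoids F0], each event of [G] at most doubles its
    probability, and the original total is at most 1/4. *)
Lemma avoids_halve G F0 :
  (forall B, B \in G ->
     #|extends B.1 B.2 :&: avoids F0| * #|V|`! <= 2 * #|extends B.1 B.2| * #|avoids F0|) ->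
  4 * (\sum_(B <- G) #|extends B.1 B.2|) <= #|V|`! ->
  #|avoids F0| <= 2 * #|avoids (G ++ F0)|.
Proof.
move=> hG wG; have f0 := fact_gt0 #|V|.
have ub := avoids_union_bound G F0.
have {ub} : #|avoids F0| * #|V|`! <= #|avoids (G ++ F0)| * #|V|`! +
    2 * (\sum_(B <- G) #|extends B.1 B.2|) * #|avoids F0|.
  apply: (leq_trans (leq_mul ub (leqnn _))); rewrite mulnDl leq_add2l.
  rewrite big_distrl big_distrr big_distrl /= big_seq [X in _ <= X]big_seq.
  exact: leq_sum.
move: f0 wG; move: #|avoids F0| #|avoids (G ++ F0)| (#|V|`!) (\sum_(_ <- _) _).
move=> a b f S f0 w h.
have w' : 4 * S * a <= f * a by rewrite leq_mul2r w orbT.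
rewrite -(leq_pmul2r f0); lia.
Qed.

(** Split [F0] into the events [F1] sharing a point with [B] and the rest [F2]. Given [avoids F2]
    alone, [B] is no likelier than unconditionally. By induction and [avoids_halve], restoring [F1]
    costs at most a factor 2. *)
Lemma local_lemma_step F0 B : subseq F0 F -> B \in F ->
  #|extends B.1 B.2 :&: avoids F0| * #|V|`! <=
    2 * #|extends B.1 B.2| * #|avoids F0|.
Proof.
have [N leN] := ubnP (size F0); elim: N => // N IH in F0 B leN *.
move=> sF0 BF.
have [e0|] := posnP #|extends B.1 B.2|.
  suff -> : #|extends B.1 B.2 :&: avoids F0| = 0 by [].
  by apply/eqP; rewrite -leqn0 -e0 subset_leq_card // subsetIl.
case/card_gt0P => p pB.
pose t := fun B' => has (hits B') (points B).
pose F1 := filter t F0; pose F2 := filter (predC t) F0.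
have uB2 := extends_uniq (uniqF BF) pB.
have avE : avoids F0 = avoids (F1 ++ F2).
  by apply: avoids_perm; rewrite perm_sym perm_filterC.
have h1 : #|extends B.1 B.2 :&: avoids F0| * #|V|`! <= #|extends B.1 B.2| * #|avoids F2|.
  rewrite -(card_extends (uniqF BF) uB2 (sizeF1 BF)) mulnCA.
  rewrite leq_mul2l; apply/orP; right.
  apply: leq_trans (extends_avoids_le (uniqF BF) uB2 (sizeF1 BF) _).
    by rewrite leq_mul2r; apply/orP; right; rewrite subset_leq_card // avE avoids_cat setIS // subsetIr.
  by exact: filter_all.
have h2 : #|avoids F2| <= 2 * #|avoids F0|.
  case: (altP (F1 =P [::])) => [F10|F1n].
    by rewrite avE F10 /= leq_pmull.
  rewrite avE; apply: avoids_halve.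
    move=> B' B'F1; apply: IH.
    - have : size F1 + size F2 = size F0 by rewrite !size_filter count_predC.
      by case: (F1) F1n => //= ? ? _; lia.
    - exact: subseq_trans (filter_subseq _ _) sF0.
    - by apply: (mem_subseq sF0); move: B'F1; rewrite mem_filter => /andP[].
  rewrite /F1 big_filter.
  have b1 := sum_filter_le t (fun B => #|extends B.1 B.2|) sF0.
  have b2 := sum_has_le F hits (fun B => #|extends B.1 B.2|) (points B).
  have szp : size (points B) <= 2 * l.
    by rewrite size_cat !size_map -(sizeF1 BF) addnn -mul2n leq_mul2l sizeF.
  have b3 : 8 * l * (\sum_(z <- points B) \sum_(B' <- F | hits B' z) #|extends B'.1 B'.2|)
      <= size (points B) * #|V|`!.
    rewrite big_distrr /= -sum1_size big_distrl /=.
    by apply: leq_sum => z _; rewrite mul1n sparseF.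
  have b4 : size (points B) * #|V|`! <= 2 * l * #|V|`! by rewrite leq_mul2r szp orbT.
  rewrite /t in b1; move: (leq_trans b1 b2) (leq_trans b3 b4).
  move: l_gt0; move: (\sum_(_ <- _ | _) _) (\sum_(_ <- _) _) (_ `!) => x y f.
  move=> lg xy; rewrite (_ : 8 * l * y = 2 * l * (4 * y)); last by lia.
  rewrite leq_pmul2l ?muln_gt0 //; lia.
by apply: leq_trans h1 _; rewrite [2 * _]mulnC -mulnA leq_mul2l h2 orbT.
Qed.

(** The events through one point have total probability at most [1/(8l)], below the 1/4 that
    [avoids_halve] allows, so each point costs one factor 2. *)
Lemma avoids_untouched_le (zs : seq (V + V)) F0 : subseq F0 F ->
  #|avoids [seq B <- F0 | ~~ has (hits B) zs]| <= 2 ^ size zs * #|avoids F0|.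
Proof.
move=> sF0; elim: zs => [|z zs IH].
  by rewrite expn0 mul1n (eq_filter (a2 := xpredT)) ?filter_predT //.
pose F1 := [seq B <- F0 | ~~ has (hits B) zs].
pose G := [seq B <- F1 | hits B z]; pose F2 := [seq B <- F1 | ~~ hits B z].
have -> : [seq B <- F0 | ~~ has (hits B) (z :: zs)] = F2.
  by rewrite /F2 /F1 -filter_predI; apply: eq_filter => B /=; rewrite negb_or.
have sF1 : subseq F1 F by apply: subseq_trans sF0; apply: filter_subseq.
have avE : avoids F1 = avoids (G ++ F2).
  by apply: avoids_perm; rewrite perm_sym perm_filterC.
rewrite expnS -mulnA; apply: leq_trans (leq_mul (leqnn 2) IH); rewrite -/F1 avE.
apply: avoids_halve.
  move=> B BG; apply: local_lemma_step.
    exact: subseq_trans (filter_subseq _ _) sF1.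
  by apply: (mem_subseq sF1); move: BG; rewrite mem_filter => /andP[].
have b1 := sum_filter_le (hits^~ z) (fun B => #|extends B.1 B.2|) sF1.
have b2 := sparseF z.
rewrite /G big_filter; apply: leq_trans b2; rewrite leq_mul //; lia.
Qed.

(** Every event has a position, so none is left untouched by the list of all positions, and
    [avoids_untouched_le] compares [avoids F] with the set of all permutations. *)
Lemma avoids_gt0 : (forall B, B \in F -> 0 < size B.1) -> 0 < #|avoids F|.
Proof.
move=> F0; have := avoids_untouched_le (map inl (enum V)) (subseq_refl F).
rewrite (eq_in_filter (a2 := pred0)) => [|B /F0 B0].
  rewrite filter_pred0 avoids_nil card_permT.
  by move/(leq_trans (fact_gt0 _)); rewrite muln_gt0 => /andP[].
apply/negbF; apply/hasP.
case E: B.1 B0 => [//|x s] _; exists (inl x); first by rewrite map_f ?mem_enum.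
by rewrite /= E inE eqxx.
Qed.

(** Discarding the events that touch one of the [2 * size ps] points costs [4 ^ size ps]; to the
    remaining ones [extends_avoids_le] applies. *)
Lemma local_lemma_spread ps vs :
  uniq ps -> uniq vs -> size ps = size vs ->
  #|extends ps vs :&: avoids F| * #|V| ^_ (size ps) <= 4 ^ size ps * #|avoids F|.
Proof.
move=> ups uvs sz.
pose F2 := [seq B <- F | ~~ has (hits B) (points (ps, vs))].
have := avoids_untouched_le (points (ps, vs)) (subseq_refl F).
rewrite size_cat !size_map /= -sz addnn -mul2n expnM -/F2.
apply: leq_trans.
apply: leq_trans (extends_avoids_le ups uvs sz (filter_all _ _)).
rewrite leq_mul2r; apply/orP; right; rewrite subset_leq_card // setIS //.
apply/subsetP => p; rewrite !inE; apply: contra => /hasP[B].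
by rewrite mem_filter => /andP[_ BF] h; apply/hasP; exists B.
Qed.

End LocalLemma.

(** * Sampling *)

Section SeqSum.
Local Open Scope ring_scope.
Variables (R : realType) (V : finType).
Implicit Types (G : seq V -> R) (s u : seq V) (L : {set {set V}}).

(** Up to the factor [#|V| ^ a], this is the expectation of [G] at [a] independent uniform
    vertices. *)
Fixpoint seqsum (a : nat) G : R :=
  if a is a'.+1 then \sum_v seqsum a' (fun s => G (v :: s)) else G [::].

Lemma ler_seqsum a G G' : (forall s, size s = a -> G s <= G' s) ->
  seqsum a G <= seqsum a G'.
Proof.
elim: a G G' => [|a IH] G G' h /=; first exact: h.
by apply: ler_sum => v _; apply: IH => s sa; apply: h => /=; rewrite sa.
Qed.

Lemma eq_seqsum a G G' : (forall s, size s = a -> G s = G' s) ->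
  seqsum a G = seqsum a G'.
Proof. by move=> h; apply/eqP; rewrite eq_le !ler_seqsum // => s /h ->. Qed.

Lemma seqsum_cat a b G :
  seqsum (a + b) G = seqsum a (fun u => seqsum b (fun s => G (u ++ s))).
Proof. by elim: a G => [|a IH] G //=; apply: eq_bigr => v _; rewrite IH. Qed.

Lemma seqsum_const a c : seqsum a (fun=> c) = #|V|%:R ^+ a * c.
Proof.
elim: a => [|a IH] /=; first by rewrite mul1r.
by rewrite (eq_bigr _ (fun v _ => IH)) sumr_const -[LHS]mulr_natl exprS mulrA.
Qed.

Lemma seqsumZ a c G : seqsum a (fun s => c * G s) = c * seqsum a G.
Proof.
by elim: a G => [|a IH] G //=; rewrite mulr_sumr; apply: eq_bigr => v _; rewrite IH.
Qed.

Lemma seqsumD a G G' : seqsum a (fun s => G s + G' s) = seqsum a G + seqsum a G'.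
Proof.
by elim: a G G' => [|a IH] G G' //=; rewrite -big_split; apply: eq_bigr => v _; rewrite IH.
Qed.

(* Compares a random permutation with independent sampling. *)
Lemma sum_extends_le ps0 vs0 ps G : uniq (ps0 ++ ps) -> size ps0 = size vs0 ->
  (forall s, 0 <= G s) ->
  \sum_(p in extends ps0 vs0) G [seq (p : {perm V}) x | x <- ps] <=
    (#|V| - size ps0 - size ps)`!%:R * seqsum (size ps) G.
Proof.
elim: ps ps0 vs0 G => [|x ps IH] ps0 vs0 G u0 sz G0 /=.
  rewrite subn0 sumr_const -[X in X <= _]mulr_natl ler_wpM2r // ler_nat.
  move: u0; rewrite cats0 => u0.
  case: (posnP #|extends ps0 vs0|) => [->//|/card_gt0P[p pE]].
  have := card_extends u0 (extends_uniq u0 pE) sz.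
  have le0 : (size ps0 <= #|V|)%N.
    by rewrite -(card_uniqP u0) max_card.
  rewrite -(ffact_fact le0) mulnC => /eqP; rewrite eqn_pmul2l ?ffact_gt0 //.
  by move/eqP ->.
rewrite (partition_big (fun p : {perm V} => p x) xpredT) //= mulr_sumr.
apply: ler_sum => v _.
have -> : (#|V| - size ps0 - (size ps).+1 = #|V| - size (x :: ps0) - size ps)%N.
  by rewrite /=; lia.
apply: le_trans (IH (x :: ps0) (v :: vs0) (fun s => G (v :: s)) _ _ _) => //.
- rewrite le_eqVlt; apply/orP; left; apply/eqP; apply: eq_big => p; first by rewrite !inE eqseq_cons andbC.
  by move=> /andP[_ /eqP ->].
- by move: u0; rewrite (uniq_catCA ps0 [:: x] ps).
by rewrite /= sz.
Qed.

Definition bounded_diff (c : R) a G := forall u v w s, (size u + (size s).+1 = a)%N ->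
  `|G (u ++ v :: s) - G (u ++ w :: s)| <= c.

(** From [1 - x <= expR (- x)] follows [expR x * (1 - x) <= 1], while [(1 - x) * (1 + x + 2x^2) = 1
    + x^2 (1 - 2x)] is at least 1. *)
Lemma expR_le_quadratic (x : R) : `|x| <= 1 / 2 -> expR x <= 1 + x + 2 * x ^+ 2.
Proof.
rewrite ler_norml => /andP[x1 x2].
have h := expR_ge1Dx (- x); have : 0 < 1 - x by lra.
have e : expR x * expR (- x) = 1 by rewrite -expRD subrr expR0.
have ep := expR_gt0 x => x3.
have : expR x * (1 - x) <= 1 by rewrite -e ler_pM2l // ; lra.
move=> h2; rewrite -(ler_pM2r x3); apply: le_trans h2 _.
have := sqr_ge0 x; nra.
Qed.

(** The entries are exposed one at a time. The conditional means [g v] differ pairwise by at most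
    [c] and average to [A], so [|A - g v| <= c]. In the quadratic bound on the exponential the
    linear terms then sum to zero. *)
Lemma mcdiarmid (c A : R) a G : 0 <= c <= 1 / 2 -> (0 < #|V|)%N ->
  bounded_diff c a G -> seqsum a G = #|V|%:R ^+ a * A ->
  seqsum a (fun s => expR (A - G s)) <= #|V|%:R ^+ a * expR (2 * c ^+ 2 * a%:R).
Proof.
move=> /andP[c0 c1] n0; have n0R : 0 < #|V|%:R :> R by rewrite ltr0n.
elim: a G A => [|a IH] G A bd /=.
  by rewrite !mul1r mulr0 => ->; rewrite subrr.
move=> GA; have na := exprn_gt0 a n0R.
pose g v := seqsum a (fun s => G (v :: s)) / #|V|%:R ^+ a.
have gE v : seqsum a (fun s => G (v :: s)) = #|V|%:R ^+ a * g v.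
  by rewrite /g mulrC divfK ?gt_eqF.
have sg : \sum_v g v = #|V|%:R * A.
  move: GA; rewrite (eq_bigr _ (fun v _ => gE v)) -mulr_sumr exprSr -mulrA.
  by apply: mulfI; rewrite gt_eqF.
have gd v w : g v - g w <= c.
  rewrite -(ler_pM2l na) mulrBr -!gE -seqsum_const lerBlDl -seqsumD.
  apply: ler_seqsum => s sa; have := bd [::] v w s; rewrite /= sa add0n => /(_ erefl).
  by rewrite ler_norml => /andP[_]; rewrite lerBlDl.
have gA v : `|A - g v| <= c.
  have sc : \sum_(w : V) c = #|V|%:R * c by rewrite sumr_const mulr_natl.
  have sv : \sum_(w : V) g v = #|V|%:R * g v by rewrite sumr_const mulr_natl.
  rewrite ler_norml -(ler_pM2l n0R) -[X in _ && X](ler_pM2l n0R) !mulrBr mulrN.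
  rewrite -sg -sc -sv -sumrB -sumrN; apply/andP; split; apply: ler_sum => w _ //.
  by have := gd v w; lra.
apply: (@le_trans _ _ (\sum_v expR (A - g v) * (#|V|%:R ^+ a * expR (2 * c ^+ 2 * a%:R)))).
  apply: ler_sum => v _; apply: le_trans (ler_wpM2l (expR_ge0 _) (IH _ _ _ (gE v))).
    rewrite -seqsumZ; apply: ler_seqsum => s _; rewrite -expRD.
    by rewrite ler_expR; lra.
  by move=> u w w' s sz; apply: (bd (v :: u)); rewrite /= addSn sz.
have -> : #|V|%:R ^+ a.+1 * expR (2 * c ^+ 2 * a.+1%:R) =
    #|V|%:R * expR (2 * c ^+ 2) * (#|V|%:R ^+ a * expR (2 * c ^+ 2 * a%:R)).
  by rewrite -addn1 natrD mulrDr mulr1 expRD addn1 exprS; ring.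
rewrite -mulr_suml.
apply: ler_wpM2r; first by rewrite mulr_ge0 ?expR_ge0 // ltW.
apply: (@le_trans _ _ (\sum_(v : V) (1 + (A - g v) + 2 * c ^+ 2))).
  apply: ler_sum => v _; apply: le_trans (expR_le_quadratic (le_trans (gA v) c1)) _.
  rewrite lerD2l ler_pM2l //; move: (gA v); rewrite ler_norml => /andP[? ?]; nra.
have card x : \sum_(v : V) x = #|V|%:R * x :> R by rewrite sumr_const mulr_natl.
rewrite !big_split /= sumrN sg !card mulr1 subrr addr0 -[X in X + _]mulr1 -mulrDr.
by rewrite ler_pM2l //; apply: expR_ge1Dx.
Qed.

(** Markov's inequality for the exponential moment at parameter 1; rescaling [G] takes the place of
    optimising the parameter. *)
Lemma mcdiarmid_tail (c A t : R) a G : 0 <= c <= 1 / 2 -> (0 < #|V|)%N ->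
  bounded_diff c a G -> seqsum a G = #|V|%:R ^+ a * A ->
  seqsum a (fun s => (G s < A - t)%R%:R) <= #|V|%:R ^+ a * expR (2 * c ^+ 2 * a%:R - t).
Proof.
move=> hc n0 bd GA; rewrite expRD mulrA mulrC.
apply: le_trans (ler_wpM2l (expR_ge0 _) (mcdiarmid hc n0 bd GA)).
rewrite -seqsumZ; apply: ler_seqsum => s _.
rewrite -expRD; case: ltP => h; last by rewrite expR_ge0.
by rewrite -expR0 ler_expR /=; lra.
Qed.

End SeqSum.

(** * Counting members of a set system in a random sample *)

Section SubsetCount.
Local Open Scope ring_scope.
Variable V : finType.
Implicit Types (s u : seq V) (L : {set {set V}}) (v : V).

Definition vlink v L : {set {set V}} := [set e : {set V} | (v \notin e) && (v |: e \in L)].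

(* The number of r-element sets of positions of s whose entries are pairwise
   distinct and form a member of L. *)
Fixpoint subcount s (r : nat) L : nat :=
  if r is r'.+1 then
    if s is v :: s' then (subcount s' r L + subcount s' r' (vlink v L))%N else 0%N
  else set0 \in L.

Lemma subcount0 s L : subcount s 0 L = (set0 \in L).
Proof. by case: s. Qed.

Lemma subcount_le_bin s r L : (subcount s r L <= 'C(size s, r))%N.
Proof.
elim: s r L => [|v s IH] [|r] L //=; rewrite ?bin0 ?leq_b1 //.
by rewrite binS leq_add.
Qed.

Lemma subcount_le s r L : uniq s ->
  (subcount s r L <= #|[set e in L | (#|e| == r) && (e \subset s)]|)%N.
Proof.
elim: s r L => [|v s IH] [|r] L //=.
- by move=> _; case: (boolP (_ \in _)) => // h; apply/card_gt0P; exists set0; rewrite !inE h cards0 /=; apply/subsetP => x; rewrite inE.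
- by move=> _; case: (boolP (_ \in _)) => // h; apply/card_gt0P; exists set0; rewrite !inE h cards0 /=; apply/subsetP => x; rewrite inE.
move=> /andP[vs us]; apply: leq_trans (leq_add (IH _ _ us) (IH _ _ us)) _.
rewrite -(@card_in_imset _ _ (fun e => v |: e) (mem [set e in vlink v L | _])); last first.
  move=> e f; rewrite !inE => /andP[/andP[ve _] _] /andP[/andP[vf _] _] E.
  by rewrite -(setU1K ve) E setU1K.
rewrite -cardsUI [X in (_ + X)%N]eq_card0 ?addn0; last first.
  move=> f; rewrite !inE; apply/negP => /andP[/andP[_ /andP[_ fs]] /imsetP[e _ E]].
  by move: vs; rewrite (subsetP fs) // E setU11.
apply: subset_leq_card; apply/subsetP => f; rewrite !inE => /orP[/andP[-> /andP[-> /= fs]]|].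
  by apply/subsetP => x /(subsetP fs); rewrite inE orbC => ->.
move=> /imsetP[e]; rewrite !inE => /andP[/andP[ve vL] /andP[/eqP es se]] ->.
rewrite vL cardsU1 ve es eqxx /=; apply/subsetP => x; rewrite !inE => /orP[->//|/(subsetP se) ->].
by rewrite orbT.
Qed.

(** Only sets of positions through the changed position matter, and there are
    ['C(size u + size s, r)] of them. *)
Lemma subcount_diff u s v w r L :
  (subcount (u ++ v :: s) r.+1 L <= subcount (u ++ w :: s) r.+1 L + 'C(size u + size s, r))%N.
Proof.
elim: u r L => [|x u IH] r L /=.
  by rewrite add0n -addnA leq_add2l; apply: leq_trans (subcount_le_bin _ _ _) (leq_addl _ _).
case: r => [|r].
  by rewrite !subcount0 addnAC leq_add2r; have := IH 0%N L; rewrite !bin0.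
rewrite addSn binS; have := IH r.+1 L; have := IH r (vlink x L).
lia.
Qed.

Lemma sum_card_vlink r L : (forall e, e \in L -> #|e| = r) ->
  (\sum_v #|vlink v L| = r * #|L|)%N.
Proof.
move=> Lr.
have E v : #|vlink v L| = (\sum_(e in L) (v \in e))%N.
  rewrite (eq_bigr (fun e : {set V} => if v \in e then 1 else 0)%N); last by move=> e _; case: (v \in e).
  rewrite -big_mkcondr /= sum1dep_card -(@card_in_imset _ _ (fun e => v |: e) (mem (vlink v L))).
    apply: eq_card => e; rewrite inE; apply/imsetP/andP => [[f]|[eL ve]].
      by rewrite !inE => /andP[_ h] ->; rewrite h setU11.
    by exists (e :\ v); rewrite ?inE ?setD1K // eqxx.
  move=> e f; rewrite !inE => /andP[ve _] /andP[vf _] E.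
  by rewrite -(setU1K ve) E setU1K.
rewrite (eq_bigr _ (fun v _ => E v)) exchange_big /= mulnC -sum_nat_const.
apply: eq_bigr => e /Lr <-; rewrite -sum1_card [RHS]big_mkcond /=.
by apply: eq_bigr => v _; case: (v \in e).
Qed.

Lemma vlink_size r L v : (forall e, e \in L -> #|e| = r.+1) ->
  forall e, e \in vlink v L -> #|e| = r.
Proof.
move=> Lr e; rewrite inE => /andP[ve /Lr]; rewrite cardsU1 ve.
by case.
Qed.

Variable R : realType.

(** Linearity of expectation: each [r]-set of positions receives a member of [L] with probability
    [r! |L| / n^r]. The induction averages over the first entry by [sum_card_vlink]. *)
Lemma subcount_mean a r L : (forall e, e \in L -> #|e| = r) ->
  seqsum a (fun s => (subcount s r L)%:R : R) * #|V|%:R ^+ r =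
  #|V|%:R ^+ a * ('C(a, r) * r`! * #|L|)%:R.
Proof.
elim: a r L => [|a IH] [|r] L Lr /=.
- rewrite bin0 fact0 mulr1 mul1r !mul1n; congr _%:R.
  rewrite (cardsD1 set0) [X in (_ + X)%N]eq_card0 ?addn0 //.
  move=> e; rewrite !inE; apply/negP => /andP[e0 /Lr /eqP]; rewrite cards_eq0.
  by rewrite (negPf e0).
- by rewrite mul0r bin0n !mul0n mulr0.
- rewrite mulr1 (eq_bigr (fun=> seqsum a (fun s => (subcount s 0 L)%:R : R))).
    rewrite sumr_const -[LHS]mulr_natl exprS -mulrA !bin0.
    by congr (_ * _); have := IH 0%N L Lr; rewrite mulr1 bin0.
  by move=> v _; apply: eq_seqsum => s _; rewrite subcount0.
have E v : seqsum a (fun s => (subcount s r.+1 L + subcount s r (vlink v L))%:R : R) * #|V|%:R ^+ r.+1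
   = #|V|%:R ^+ a * ('C(a, r.+1) * r.+1`! * #|L|)%:R + #|V|%:R ^+ a.+1 * ('C(a, r) * r`!)%:R * #|vlink v L|%:R.
  under eq_seqsum do rewrite natrD.
  rewrite seqsumD mulrDl (IH _ _ Lr); congr (_ + _).
  rewrite exprSr mulrA (IH _ _ (vlink_size Lr)) !natrM exprS; ring.
rewrite mulr_suml (eq_bigr _ (fun v _ => E v)) big_split /= sumr_const.
rewrite -[X in X + _]mulr_natl -mulr_sumr -natr_sum (sum_card_vlink Lr) mulrA -exprS.
rewrite -mulrA -mulrDr; congr (_ * _); rewrite binS -natrM -natrD; congr _%:R.
rewrite factS; ring.
Qed.

Lemma sampling a r L (rho lambda : R) :
  (0 < #|V|)%N -> (0 < r <= a)%N -> (forall e, e \in L -> #|e| = r) ->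
  0 < lambda <= 1 -> rho * #|V|%:R ^+ r <= (r`! * #|L|)%:R ->
  seqsum a (fun s => ((subcount s r L)%:R < (rho - lambda) * 'C(a, r)%:R)%R%:R : R) <=
  #|V|%:R ^+ a * expR (- (lambda ^+ 2 / (8 * r%:R ^+ 2) * a%:R)).
Proof.
move=> n0 /andP[r0 ra] Lr /andP[l0 l1] hrho.
have n0R : 0 < #|V|%:R :> R by rewrite ltr0n.
have r0R : 1 <= r%:R :> R by rewrite (ler_nat _ 1).
have a0R : 0 < a%:R :> R by rewrite ltr0n (leq_trans r0).
have b0R : 0 < 'C(a, r)%:R :> R by rewrite ltr0n bin_gt0.
(* Scaled by [th], the count changes by at most [h * r] with one entry. The tail exponent is then
   [(2 h^2 r^2 - h lambda) a]; this [h] minimises it, at [- lambda^2 a / (8 r^2)]. *)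
pose h := lambda / (4 * r%:R ^+ 2); pose th := h * a%:R / 'C(a, r)%:R.
have h0 : 0 < h by rewrite divr_gt0 // mulr_gt0 // exprn_gt0 //; lra.
have th0 : 0 < th by rewrite divr_gt0 // mulr_gt0.
pose rho' : R := (r`! * #|L|)%:R / #|V|%:R ^+ r.
have le_rho : rho <= rho' by rewrite ler_pdivlMr ?exprn_gt0.
pose A := th * ('C(a, r)%:R * rho').
have GA : seqsum a (fun s => th * (subcount s r L)%:R) = #|V|%:R ^+ a * A.
  have nr : #|V|%:R ^+ r != 0 :> R by rewrite gt_eqF ?exprn_gt0.
  apply: (mulIf nr); rewrite seqsumZ -mulrA subcount_mean // /A /rho' !natrM.
  by field.
have hc : 0 <= h * r%:R <= 1 / 2.
  have -> : h * r%:R = lambda / (4 * r%:R) by rewrite /h; field; lra.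
  by rewrite divr_ge0 ?ler_pdivrMr; lra.
have bd : bounded_diff (h * r%:R) a (fun s => th * (subcount s r L)%:R).
  move=> u v w s sz; rewrite -mulrBr normrM (gtr0_norm th0).
  have -> : h * r%:R = th * 'C(a.-1, r.-1)%:R.
    have := mul_bin_diag a r.-1; rewrite prednK //.
    move=> /(congr1 (fun x => x%:R : R)); rewrite !natrM => E.
    have -> : 'C(a.-1, r.-1)%:R = r%:R * 'C(a, r)%:R / a%:R :> R.
      by rewrite -E mulrAC mulfV ?mul1r ?gt_eqF.
    by rewrite /th; field; rewrite !gt_eqF.
  rewrite ler_pM2l //; case: r r0 {ra Lr hrho r0R b0R h th h0 th0 rho' le_rho A GA hc} => // r _.
  rewrite -sz addnS /= ler_norml lerBlDl lerNl opprB lerBlDl -!natrD !ler_nat.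
  by rewrite !subcount_diff.
apply: le_trans (le_trans (mcdiarmid_tail (th * (lambda * 'C(a, r)%:R)) hc n0 bd GA) _).
  apply: ler_seqsum => s _; rewrite ler_nat.
  case: (ltP _ ((rho - lambda) * _)) => // lt1; rewrite lt0b.
  rewrite /A -mulrBr ltr_pM2l //; apply: lt_le_trans lt1 _.
  rewrite [lambda * _]mulrC -mulrBr mulrC ler_pM2l //; lra.
rewrite ler_pM2l ?exprn_gt0 // ler_expR.
have -> : th * (lambda * 'C(a, r)%:R) = h * a%:R * lambda by rewrite /th; field; rewrite gt_eqF.
rewrite /h le_eqVlt; apply/orP; left; apply/eqP; field; rewrite gt_eqF //; lra.
Qed.

End SubsetCount.

(** * Links *)

Section Links.
Variable V : finType.
Implicit Types (H M : {set {set V}}) (S T X Y Z e : {set V}).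

Lemma exists_subset_card X c : c <= #|X| -> exists2 Y : {set V}, Y \subset X & #|Y| = c.
Proof.
move=> cX; have : 0 < #|[set A : {set V} | A \subset X & #|A| == c]|.
  by rewrite cards_draws bin_gt0.
by case/card_gt0P => Y; rewrite inE => /andP[YX /eqP Yc]; exists Y.
Qed.

Definition link H S : {set {set V}} := [set T : {set V} | [disjoint S & T] && (S :|: T \in H)].

Definition link_in H S X : {set {set V}} := [set T in link H S | T \subset X].

Lemma link_card H S T k : uniform k H -> T \in link H S -> #|T| = k - #|S|.
Proof.
move=> /forall_inP uH; rewrite inE => /andP[dST /uH/eqP <-].
by rewrite cardsU disjoint_setI0 // cards0 subn0 addKn.
Qed.

Lemma link_in_card H S X T k : uniform k H -> T \in link_in H S X -> #|T| = k - #|S|.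
Proof. by move=> uH; rewrite inE => /andP[/(link_card uH)]. Qed.

Lemma card_link H S : #|link H S| = degree H S.
Proof.
rewrite /degree -(@card_in_imset _ _ (fun T => S :|: T) (mem (link H S))).
  apply: eq_card => e; rewrite inE; apply/imsetP/andP => [[T]|[eH Se]].
    by rewrite inE => /andP[_ h] ->; rewrite h subsetUl.
  exists (e :\: S); last by rewrite setDE setUIr setUCr setIT (setUidPr Se).
  rewrite inE setDE setUIr setUCr setIT (setUidPr Se) eH andbT.
  by rewrite -setI_eq0 setIC -setIA [~: S :&: S]setIC setICr setI0.
have D T : [disjoint S & T] -> (S :|: T) :\: S = T.
  move=> dST; rewrite setDUl setDv set0U; apply/setDidPl.
  by rewrite disjoint_sym.
move=> T1 T2; rewrite !inE => /andP[d1 _] /andP[d2 _] E.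
by rewrite -(D _ d1) E D.
Qed.

Lemma sum_card_mem X r z : z \in X ->
  #|[set T : {set V} | [&& T \subset X, #|T| == r.+1 & z \in T]]| <= 'C(#|X|.-1, r).
Proof.
move=> zX; have -> : #|X|.-1 = #|X :\ z| by rewrite (cardsD1 z X) zX.
rewrite -cards_draws -(@card_in_imset _ _ (fun T => T :\ z) (mem [set T : {set V} | _])).
  apply/subset_leq_card/subsetP => _ /imsetP[T + ->].
  rewrite !inE => /and3P[TX /eqP Tr zT]; rewrite setSD //=.
  by move: Tr; rewrite (cardsD1 z) zT add1n => /eqP; rewrite eqSS.
move=> A B; rewrite !inE => /and3P[_ _ zA] /and3P[_ _ zB] E.
by rewrite -(setD1K zA) E setD1K.
Qed.

(** Every lost set contains some [z] in [Z], and [sum_card_mem] bounds the number of those through a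
    given [z]. *)
Lemma link_in_remove H S X Z k r : uniform k H -> k - #|S| = r.+1 -> Z \subset X ->
  #|link_in H S X| <= #|link_in H S (X :\: Z)| + #|Z| * 'C(#|X|.-1, r).
Proof.
move=> uH kr ZX; rewrite -sum_nat_const.
apply: (@leq_trans (#|link_in H S (X :\: Z)| + \sum_(z in Z)
    #|[set T : {set V} | [&& T \subset X, #|T| == r.+1 & z \in T]]|)); last first.
  by rewrite leq_add2l; apply: leq_sum => z /(subsetP ZX); apply: sum_card_mem.
apply: leq_trans (_ : #|link_in H S (X :\: Z)| +
  #|\bigcup_(z in Z) [set T : {set V} | [&& T \subset X, #|T| == r.+1 & z \in T]]| <= _).
  apply: leq_trans (leq_card_setU _ _); apply/subset_leq_card/subsetP => T TL.
  rewrite inE; case: (boolP [disjoint T & Z]) => TZ; apply/orP.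
    by left; move: TL; rewrite !inE subsetD TZ => /andP[-> ->].
  right; move: TZ; rewrite -setI_eq0 => /set0Pn[z /setIP[zT zZ]].
  apply/bigcupP; exists z => //; rewrite inE zT (link_in_card uH TL) kr eqxx.
  by move: TL; rewrite inE => /andP[_ ->].
rewrite leq_add2l; elim/big_rec2: _ => [|z n A _ h]; first by rewrite cards0.
by apply: leq_trans (leq_card_setU _ _) _; rewrite leq_add2l.
Qed.


Local Open Scope ring_scope.

Lemma link_in_density (R : realType) H S X Z k (q eps : R) :
  uniform k H -> (#|S| < k)%N -> Z \subset X -> X != set0 ->
  (#|Z| * (k - #|S|))%:R <= eps * #|X|%:R ->
  q * 'C(#|X|, k - #|S|)%:R <= #|link_in H S X|%:R ->
  (q - eps) * 'C(#|X|, k - #|S|)%:R <= #|link_in H S (X :\: Z)|%:R.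
Proof.
move=> uH Sk ZX X0; case E: (k - #|S|)%N => [|r]; first by lia.
move=> hZ hq; have := link_in_remove uH E ZX; rewrite -(ler_nat R) natrD => hr.
have X0R : 0 < #|X|%:R :> R by rewrite ltr0n card_gt0.
suff : (#|Z| * 'C(#|X|.-1, r))%:R <= eps * 'C(#|X|, r.+1)%:R by lra.
rewrite -(ler_pM2l X0R) -natrM mulnCA mul_bin_diag mulnA natrM mulrA.
by rewrite [_ * eps]mulrC ler_wpM2r.
Qed.

End Links.

(** * Optimal matchings inside a vertex subset *)

Section Transport.
Variables (V : finType) (k : nat).
Implicit Types (H M : {set {set V}}).

(** As [forces_optimal_matching] speaks of hypergraphs on an ordinal, the edges inside [Y] are
    pulled back along the enumeration of [Y] and the matching found is mapped forward. *)
Lemma matching_on_subset (d D : nat) H (Y : {set V}) :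
  (d <= k)%N -> (d <= #|Y|)%N -> forces_optimal_matching d k #|Y| D -> uniform k H ->
  (forall S : {set V}, S \subset Y -> #|S| = d -> (D <= #|link_in H S Y|)%N) ->
  exists M : {set {set V}}, [/\ M \subset H, trivIset M, cover M \subset Y & #|M| = (#|Y| %/ k)%N].
Proof.
move=> dk dY /forallP fD uH hD; have uH' := forall_inP uH.
pose f := @enum_val _ (mem Y); have fI : injective f by exact: enum_val_inj.
have fY i : f i \in Y by exact: enum_valP.
have f_im (A : {set V}) : A \subset Y -> f @: (f @^-1: A) = A.
  move=> /subsetP AY; apply/setP => x; apply/imsetP/idP => [[i]|xA].
    by rewrite inE => ? ->.
  by exists (enum_rank_in (AY x xA) x); rewrite ?inE /f ?enum_rankK_in ?AY.
have imI : injective (fun A : {set 'I_#|Y|} => f @: A) by exact: imset_inj.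
pose H' : {set {set 'I_#|Y|}} := [set e : {set _} | f @: e \in H].
have u' : uniform k H'.
  by apply/forall_inP => e; rewrite inE => /uH'; rewrite card_imset.
have degS (S : {set 'I_#|Y|}) : #|S| = d -> (D <= degree H' S)%N.
  move=> Sd; have := hD (f @: S); rewrite card_imset // => /(_ _ Sd)/leq_trans; apply.
    by apply/subsetP => _ /imsetP[i _ ->].
  rewrite -card_link -(card_imset (mem (link H' S)) imI).
  apply/subset_leq_card/subsetP => T; rewrite !inE => /andP[/andP[dST STH] TY].
  apply/imsetP; exists (f @^-1: T); rewrite ?f_im // !inE imsetU f_im // STH andbT.
  rewrite -setI_eq0; apply/eqP/setP => i; rewrite !inE; apply/negP => /andP[iS fiT].
  by have /pred0P/(_ (f i)) := dST; rewrite /= fiT imset_f.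
have min' : (D <= min_degree d H')%N.
  (* The minimum starts from the default [#|H'|], which is at least [D] too, because some [d]-set
     exists. *)
  have [S Sd0 Sd] := @exists_subset_card _ [set: 'I_#|Y|] d ltac:(by rewrite cardsT card_ord).
  rewrite /min_degree; elim/big_ind: _ => [|x y|A /eqP/degS//].
    apply: leq_trans (degS S Sd) _.
    by apply/subset_leq_card/subsetP => e; rewrite inE => /andP[].
  by rewrite leq_min => -> ->.
have /implyP/(_ _)/existsP[|M' /andP[/andP[M'H tM'] /eqP cM']] := fD H'; first by rewrite u'.
exists [set f @: e | e : {set 'I_#|Y|} in M']; split.
- by apply/subsetP => _ /imsetP[e /(subsetP M'H) + ->]; rewrite inE.
- apply/trivIsetP => _ _ /imsetP[a aM ->] /imsetP[b bM ->] ab.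
  have nab : a != b by apply: contraNneq ab => ->.
  by rewrite imset_disjoint ?(trivIsetP tM') //; exact: in2W.
- by apply/bigcupsP => _ /imsetP[e _ ->]; apply/subsetP => _ /imsetP[i _ ->].
- by rewrite card_imset // cM' card_ord.
Qed.

Lemma card_cover H M : uniform k H -> M \subset H -> trivIset M -> #|cover M| = (k * #|M|)%N.
Proof.
move=> /forall_inP uH MH /eqP <-; rewrite mulnC -sum_nat_const.
by apply: eq_bigr => e /(subsetP MH)/uH/eqP.
Qed.

End Transport.

(** * Matchings along a chain of blocks *)

Section Chain.
Variables (R : realType) (V : finType) (H : {set {set V}}) (d k s N : nat) (q eps : R).
Hypotheses (uH : uniform k H) (dk : 0 < d < k) (sk : s < k) (epsq : (eps < q)%R).
Implicit Types (M : {set {set V}}) (S X Y Z W : {set V}).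

Definition rich W X := forall S : {set V}, S \subset W -> #|S| = d ->
  (q * 'C(#|X|, k - d)%:R <= #|link_in H S X|%:R)%R.

(** Here [N] is the number of vertices that a block can afford to lose: [d] others remain, and link
    densities drop by at most [eps]. *)
Definition large X := (d + N <= #|X|) /\ ((N * k)%:R <= eps * #|X|%:R)%R.

Lemma rich_remove W X Z S : rich W X -> large X -> Z \subset X -> #|Z| <= N ->
  S \subset W -> #|S| = d ->
  ((q - eps) * 'C(#|X|, k - d)%:R <= #|link_in H S (X :\: Z)|%:R)%R.
Proof.
move=> rX [lX1 lX2] ZX ZN SW Sd; rewrite -Sd; apply: link_in_density => //.
- by rewrite Sd; case/andP: dk.
- by rewrite -card_gt0; lia.
- by apply: le_trans lX2; rewrite ler_nat leq_mul // leq_subr.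
- by rewrite Sd; apply: rX.
Qed.

Lemma cover_greedily W X (L : {set V}) : rich W X -> large X -> X \subset W -> L \subset W -> [disjoint L & X] ->
  (k.-1 * #|L| <= N)%N ->
  exists M, [/\ M \subset H, trivIset M, cover M \subset L :|: X, L \subset cover M
    & #|X :&: cover M| <= k.-1 * #|L|].
Proof.
move=> rX lX XW; move En : #|L| => n; elim: n => [|n IH] in L En *.
  move=> _ _ _; exists set0; rewrite sub0set /cover big_set0 setI0 cards0 sub0set.
  split=> //; last by rewrite (cards0_eq En) sub0set.
  by apply/trivIsetP => A B; rewrite inE.
move=> LW dLX kN.
have /set0Pn[v vL] : L != set0 by rewrite -card_gt0 En.
have L'L : L :\ v \subset L by rewrite subD1set.
have [|//|||M [MH tM cM LM XM]] := IH (L :\ v).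
- by apply/eqP; rewrite -eqSS -En (cardsD1 v L) vL.
- exact: subset_trans LW.
- exact: disjointWl dLX.
- by apply: leq_trans kN; rewrite leq_mul2l leqnSn orbT.
pose Z := X :&: cover M.
have ZX : Z \subset X by rewrite subsetIl.
have ZN : #|Z| <= N by apply: leq_trans XM (leq_trans _ kN); rewrite leq_mul2l leqnSn orbT.
have vX : v \notin X by have /pred0P/(_ v)/= := dLX; rewrite vL /= => ->.
have vM : v \notin cover M.
  by apply: contra vX => /(subsetP cM); rewrite !inE eqxx.
have [d0 dk'] := andP dk; have [lX1 lX2] := lX.
have [S0 S0X S0d] : exists2 S0 : {set V}, S0 \subset X :\: Z & #|S0| = d.-1.
  apply: exists_subset_card; rewrite cardsDS //; clear -lX1 ZN; lia.
pose S := v |: S0.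
have vS0 : v \notin S0 by apply: contra vX => /(subsetP S0X); rewrite inE => /andP[].
have Sd : #|S| = d by rewrite cardsU1 vS0 S0d add1n prednK.
have SX : S0 \subset X by apply: subset_trans S0X (subsetDl _ _).
have SW : S \subset W.
  by rewrite subUset sub1set (subsetP LW) //= (subset_trans SX XW).
have : (0 < #|link_in H S (X :\: Z)|%:R :> R)%R.
  apply: lt_le_trans (rich_remove rX lX ZX ZN SW Sd).
  rewrite mulr_gt0 ?subr_gt0 // ltr0n bin_gt0.
  have : k.-1 <= N by apply: leq_trans kN; rewrite mulnS leq_addr.
  by clear -lX1 d0; lia.
rewrite ltr0n => /card_gt0P[T]; rewrite !inE => /andP[/andP[dST STH] TXZ].
pose e := S :|: T; have eXv : e \subset v |: (X :\: Z).
  by rewrite /e /S subUset (subset_trans TXZ (subsetUr _ _)) setUS.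
have eM : [disjoint e & cover M].
  apply: (disjointWl eXv); rewrite -setI_eq0; apply/eqP/setP => x; rewrite !inE.
  case: (eqVneq x v) => [->|_] /=; first by rewrite (negPf vM).
  by case: (x \in X); rewrite ?andbF //= -!andbA andNb.
exists (e |: M); split.
- by rewrite subUset sub1set STH.
- apply: trivIsetU => //; first exact: trivIset1.
  by rewrite cover1.
- rewrite /cover bigcup_setU big_set1 subUset; apply/andP; split.
    apply: subset_trans eXv _; rewrite subUset sub1set inE vL /=.
    by apply: subset_trans (subsetDl _ _) (subsetUr _ _).
  by apply: subset_trans cM _; rewrite setSU.
- apply/subsetP => x xL; rewrite /cover bigcup_setU big_set1 inE.
  case: (eqVneq x v) => [->|xv]; first by rewrite /e /S !inE eqxx.
  by rewrite [X in _ || X](subsetP LM) ?orbT // !inE xv.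
rewrite /cover bigcup_setU big_set1 setIUr.
apply: leq_trans (leq_card_setU _ _) _; rewrite mulnS leq_add //.
have /eqP <- := forall_inP uH _ STH; rewrite (cardsD1 v (S :|: T)) (_ : v \in S :|: T) ?add1n; last by rewrite !inE eqxx.
apply/subset_leq_card/subsetP => x; rewrite !inE => /andP[xX ->]; rewrite andbT.
by apply: contraNneq vX => <-.
Qed.

(* The leftover of size < k + s is what is passed on to the next block: s
   vertices missed by the optimal matching and fewer than k vertices dropped to
   adjust the residue modulo k. *)
Lemma absorb W X (L : {set V}) : rich W X -> large X -> X \subset W -> L \subset W ->
  [disjoint L & X] -> k.-1 * #|L| + k <= N ->
  (forall Y, Y \subset X -> #|X| <= #|Y| + N -> #|Y| %% k = s ->
     exists2 D, forces_optimal_matching d k #|Y| D & (D%:R <= (q - eps) * 'C(#|X|, k - d)%:R)%R) ->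
  exists M, [/\ M \subset H, trivIset M, cover M \subset L :|: X, L \subset cover M
    & #|X :\: cover M| < s + k].
Proof.
move=> rX lX XW LW dLX LN hY; have [d0 dk'] := andP dk; have [lX1 lX2] := lX.
have [|M1 [M1H tM1 cM1 LM1 XM1]] := cover_greedily rX lX XW LW dLX.
  exact: leq_trans (leq_addr _ _) LN.
(* Dropping [c] vertices makes the size congruent to [s] modulo [k]; adding [k - s] stands for
   subtracting [s]. *)
pose Y0 := X :\: cover M1; pose c := (#|Y0| + (k - s)) %% k.
have ck : c < k by rewrite ltn_mod (leq_ltn_trans _ sk).
have cY0 : #|X :&: cover M1| + #|Y0| = #|X| by rewrite cardsID.
have cle : c <= #|Y0| by clear -ck cY0 XM1 LN lX1; lia.
have [Y YY0 Yc] : exists2 Y : {set V}, Y \subset Y0 & #|Y| = #|Y0| - c.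
  by apply: exists_subset_card; rewrite leq_subr.
have YX : Y \subset X by apply: subset_trans YY0 (subsetDl _ _).
have Ys : #|Y| %% k = s.
  have E : #|Y| + k = s + (#|Y0| + (k - s)) %/ k * k.
    have := divn_eq (#|Y0| + (k - s)) k; rewrite -/c Yc; clear -sk cle; lia.
  by rewrite -[LHS]modnDr E addnC modnMDl modn_small.
have XYN : #|X| <= #|Y| + N by clear -Yc cY0 XM1 LN ck; lia.
have [D fD Dle] := hY Y YX XYN Ys.
have [||M2 [M2H tM2 cM2 nM2]] := matching_on_subset (ltnW dk') _ fD uH.
- by clear -XYN lX1; lia.
- move=> S SY Sd; rewrite -(ler_nat R); apply: le_trans Dle _.
  rewrite (_ : Y = X :\: (X :\: Y)); last by rewrite setDDr setDv set0U (setIidPr YX).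
  apply: rich_remove (rX) _ _ _ _ _ => //; rewrite ?subsetDl //.
    by rewrite cardsDS //; clear -XYN; lia.
  by apply: subset_trans SY (subset_trans YX XW).
have d12 : [disjoint cover M1 & cover M2].
  rewrite disjoint_sym; apply: disjointWl (subset_trans cM2 YY0) _.
  by rewrite -setI_eq0 /Y0 setDE -setIA [~: _ :&: _]setIC setICr setI0.
exists (M1 :|: M2); have cU : cover (M1 :|: M2) = cover M1 :|: cover M2.
  by rewrite /cover bigcup_setU.
split; rewrite ?cU.
- by rewrite subUset M1H.
- exact: trivIsetU.
- by rewrite subUset cM1 (subset_trans cM2) // (subset_trans YX) // subsetUr.
- exact: subset_trans LM1 (subsetUl _ _).
rewrite -setDDl -/Y0 cardsDS ?(subset_trans cM2) // (card_cover uH M2H tM2) nM2.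
have := divn_eq #|Y| k; rewrite Ys mulnC; clear -Yc cle ck; lia.
Qed.

Variables (f : V -> nat) (l : nat).
Hypotheses (l0 : 0 < l) (fl : forall x, f x < l) (ns : #|V| %% k = s).
Definition block i : {set V} := [set x | f x == i].
(** The successor form makes [window 0] equal to [block 0]. *)
Definition window i : {set V} := [set x | (f x == i) || ((f x).+1 == i)].
Hypothesis N_large : k * k.*2 <= N.
Hypothesis rich_window : forall i, i < l -> rich (window i) (block i).
Hypothesis large_block : forall i, i < l -> large (block i).
Hypothesis threshold_block : forall i Y, i < l -> Y \subset block i ->
  #|block i| <= #|Y| + N -> #|Y| %% k = s ->
  exists2 D, forces_optimal_matching d k #|Y| D
    & (D%:R <= (q - eps) * 'C(#|block i|, k - d)%:R)%R.

(** Induction on [i]: [absorb] covers what is left of block [i] by edges using block [i.+1], so all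
    new edges lie in [window i.+1] and are disjoint from the earlier ones. *)
Lemma chain_prefix i : i < l -> exists M, [/\ M \subset H, trivIset M,
   forall e, e \in M -> exists2 j, j < l & e \subset window j,
   (cover M \subset [set x | f x <= i]) && ([set x | f x < i] \subset cover M)
   & #|block i :\: cover M| < s + k].
Proof.
have bw i0 : block i0 \subset window i0.
  by apply/subsetP => x; rewrite !inE => ->.
elim: i => [|i IH] il.
  have [||||M [MH tM cM _ XM]] := absorb (rich_window il) (large_block il) (bw 0) (L := set0).
  - by rewrite sub0set.
  - by rewrite -setI_eq0 set0I.
  - rewrite cards0; clear -N_large sk; nia.
  - by move=> Y; apply: threshold_block.
  exists M; split=> //.
    move=> e eM; exists 0 => //; apply: subset_trans (bw 0).
    by rewrite -[block 0]set0U; apply: subset_trans cM; apply: bigcup_sup.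
  rewrite (_ : [set x | f x < 0] = set0) ?sub0set ?andbT; last by apply/setP => x; rewrite !inE.
  by apply: subset_trans cM _; rewrite set0U; apply/subsetP => x; rewrite !inE => /eqP ->.
have [M [MH tM wM /andP[cM1 cM2] XM]] := IH (ltnW il).
pose L := block i :\: cover M.
have [||||M' [M'H tM' cM' LM' XM']] := absorb (rich_window il) (large_block il) (bw i.+1) (L := L).
- by apply/subsetP => x; rewrite !inE => /andP[_ /eqP ->]; rewrite eqxx orbT.
- rewrite -setI_eq0; apply/eqP/setP => x; rewrite !inE.
  by case: (eqVneq (f x) i) => [->|]; rewrite ?andbF //= ltn_eqF // andbF.
(* The leftover has fewer than [s + k < 2k] vertices, so [k.-1 * #|L| + k] is at most [2 k^2]. *)
- apply: leq_trans N_large; rewrite -/L in XM; clear -XM sk; nia.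
- by move=> Y; apply: threshold_block.
have cU : cover (M' :|: M) = cover M' :|: cover M by rewrite /cover bigcup_setU.
exists (M' :|: M); split; rewrite ?cU.
- by rewrite subUset MH M'H.
- apply: trivIsetU => //; apply: disjointWl cM' _; rewrite -setI_eq0.
  apply/eqP/setP => x; rewrite !inE; apply/negP => /andP[/orP[/andP[/negP]//|/eqP fx]].
  by move=> /(subsetP cM1); rewrite inE fx ltnn.
- move=> e /setUP[eM|/wM//]; exists i.+1 => //.
  have : e \subset L :|: block i.+1 by apply: subset_trans cM'; apply: bigcup_sup.
  move=> /subset_trans; apply; apply/subsetP => x; rewrite !inE.
  by case/orP=> [/andP[_ /eqP->]|->//]; rewrite eqxx orbT.
- apply/andP; split.
    rewrite subUset; apply/andP; split.
      apply: subset_trans cM' _; apply/subsetP => x; rewrite !inE.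
      by case/orP => [/andP[_ /eqP->]|/eqP->].
    by apply: subset_trans cM1 _; apply/subsetP => x; rewrite !inE => /leqW.
  apply/subsetP => x; rewrite inE ltnS leq_eqVlt => /orP[fx|fx]; rewrite inE.
    case: (boolP (x \in cover M)) => xM; rewrite ?orbT ?orbF //.
    by rewrite (subsetP LM') // !inE xM.
  by rewrite orbC (subsetP cM2) ?inE.
apply: leq_ltn_trans XM'; apply/subset_leq_card/setDS; exact: subsetUl.
Qed.

(** Fewer than [s + k] vertices, all in the last block, stay uncovered. Their number is congruent to
    [#|V|], hence to [s], modulo [k], so it is exactly [s]. *)
Lemma chain_matching : exists2 M, M \in optimal_matchings k H &
  forall e, e \in M -> exists2 j, j < l & e \subset window j.
Proof.
have [|M [MH tM wM /andP[_ cM] XM]] := @chain_prefix l.-1; first by rewrite prednK.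
exists M => //; rewrite inE /optimal_matching /matching MH tM /=; apply/eqP.
have sub : ~: cover M \subset block l.-1 :\: cover M.
  apply/subsetP => x; rewrite !inE => xM; rewrite xM eqn_leq -ltnS prednK // fl /=.
  by rewrite leqNgt; apply: contra xM => fx; rewrite (subsetP cM) ?inE.
have := leq_ltn_trans (subset_leq_card sub) XM => h.
have := cardsC (cover M); rewrite (card_cover uH MH tM) => E.
move: ns; rewrite -E mulnC modnMDl divnMDl; last exact: leq_ltn_trans sk.
move=> hs; rewrite divn_small ?addn0 //.
have := divn_eq #|~: cover M| k; rewrite hs => E'.
case: (_ %/ k) E' => [|n] E'; clear -E' h sk; [lia | nia].
Qed.
End Chain.

(** * The threshold *)

Lemma degree_le_bin (V : finType) (H : {set {set V}}) k (S : {set V}) :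
  uniform k H -> (degree H S <= 'C(#|V| - #|S|, k - #|S|))%N.
Proof.
move=> uH; rewrite -card_link.
have -> : (#|V| - #|S| = #|~: S|)%N by rewrite -(cardsC S) addKn.
rewrite -cards_draws; apply/subset_leq_card/subsetP => T TL.
rewrite inE (link_card uH TL) eqxx andbT -disjoints_subset disjoint_sym.
by move: TL; rewrite inE => /andP[].
Qed.

Lemma min_degree_le (V : finType) (H : {set {set V}}) d (S : {set V}) :
  #|S| = d -> (min_degree d H <= degree H S)%N.
Proof.
move=> /eqP Sd; rewrite /min_degree; have := mem_index_enum S.
elim: (index_enum _) => // A r IH; rewrite inE big_cons => /predU1P[<-|/IH h].
  by rewrite Sd geq_minl.
by case: ifP => // _; apply: leq_trans (geq_minr _ _) h.
Qed.

(** No minimum [d]-degree exceeds the binomial coefficient, so its successor forces a matching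
    vacuously. *)
Lemma optimal_threshold_le d k n : (d <= n)%N ->
  (optimal_threshold d k n <= ('C(n - d, k - d)).+1)%N.
Proof.
move=> dn; rewrite /optimal_threshold; case: ex_minnP => D _; apply.
apply/forallP => H; apply/implyP => /andP[uH].
have [S _ Sd] : exists2 S : {set 'I_n}, S \subset [set: 'I_n] & #|S| = d.
  by apply: exists_subset_card; rewrite cardsT card_ord.
move=> /leq_trans/(_ (min_degree_le H Sd))/leq_trans/(_ (degree_le_bin S uH)).
by rewrite card_ord Sd ltnn.
Qed.

Section MuBar.
Local Open Scope ring_scope.
Import classical_sets normedtype.
Variables (R : realType) (d k s : nat).
Hypotheses (dk : (0 < d < k)%N) (sk : (s < k)%N).
Let u := threshold_ratio R d k s.

Lemma threshold_ratio_ge0 j : 0 <= u j.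
Proof. by rewrite /u /threshold_ratio divr_ge0. Qed.

Lemma threshold_ratio_le2 j : u j <= 2.
Proof.
rewrite /u /threshold_ratio; set n := (k * j + s)%N; have [d0 dk'] := andP dk.
have [kn|nk] := leqP k n; last first.
  by rewrite bin_small ?invr0 ?mulr0 //; lia.
have b0 : (0 < 'C(n - d, k - d))%N by rewrite bin_gt0 leq_sub2r.
rewrite ler_pdivrMr ?ltr0n // -natrM ler_nat.
apply: leq_trans (optimal_threshold_le k (ltnW (leq_trans dk' kn))) _.
by rewrite mul2n -addnn -addn1 leq_add2l.
Qed.

Lemma mu_barE : mu_bar R d k s = inf (range (sups u)).
Proof.
rewrite /mu_bar limn_supE //; exists 2; split; first exact: num_real.
move=> M M2 j _ /=; rewrite ger0_norm ?threshold_ratio_ge0 //.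
exact: le_trans (threshold_ratio_le2 j) (ltW M2).
Qed.

Lemma ratio_le_sups j J : (J <= j)%N -> u j <= sups u J.
Proof.
move=> Jj; apply: ub_le_sup; last by exists j.
by exists 2 => _ [i _ <-]; apply: threshold_ratio_le2.
Qed.

Lemma has_inf_sups : has_inf (range (sups u)).
Proof.
split; first by exists (sups u 0%N); exists 0%N.
exists 0 => _ [J _ <-]; exact: le_trans (threshold_ratio_ge0 J) (ratio_le_sups (leqnn J)).
Qed.

Lemma mu_bar_ge0 : 0 <= mu_bar R d k s.
Proof.
rewrite mu_barE; apply: lb_le_inf; first by case: has_inf_sups.
move=> _ [J _ <-]; exact: le_trans (threshold_ratio_ge0 J) (ratio_le_sups (leqnn J)).
Qed.

Lemma optimal_threshold_eventually (eps : R) : 0 < eps ->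
  exists M0, forall M, (M0 <= M)%N -> (M %% k = s)%N ->
    exists2 D, forces_optimal_matching d k M D &
      D%:R <= (mu_bar R d k s + eps) * 'C(M - d, k - d)%:R.
Proof.
move=> eps0; have [_ [J _ <-] lt] := inf_adherent eps0 has_inf_sups.
rewrite -mu_barE in lt; have [d0 dk'] := andP dk.
(* This bound puts the index [M %/ k] beyond [J], and gives [k <= M], so that the denominator is
   positive and can be cleared. *)
exists (k * J.+1)%N => M MJ Ms; exists (optimal_threshold d k M).
  by rewrite /optimal_threshold; case: ex_minnP.
have k0 : (0 < k)%N by apply: ltn_trans dk'.
have JM : (J.+1 <= M %/ k)%N by rewrite leq_divRL // mulnC.
have kM : (k <= M)%N by apply: leq_trans MJ; rewrite mulnS leq_addr.
have := le_lt_trans (ratio_le_sups (ltnW JM)) lt.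
rewrite /u /threshold_ratio.
have -> : (k * (M %/ k) + s = M)%N by rewrite mulnC -Ms -divn_eq.
by rewrite ltr_pdivrMr ?ltr0n ?bin_gt0 ?leq_sub2r // => /ltW.
Qed.
End MuBar.

(** * Windows *)

Section Windows.
Variables (V : finType) (N l : nat) (W : 'I_N -> {set V}) (bad : 'I_N -> pred {perm V}).
Hypothesis l_gt0 : 0 < l.
Hypothesis W_le : forall i, #|W i| <= l.
Hypothesis W_n0 : forall i, W i != set0.
Hypothesis W_deg : forall x, \sum_i (x \in W i) <= 2.
Hypothesis bad_local : forall i (p p' : {perm V}), {in W i, p =1 p'} -> bad i p = bad i p'.
(** Since [(#|V|.-1)!] permutations send [x] to [v], this bounds by [1/(16l)] the probability of a
    bad window given one of its values. *)
Hypothesis bad_rare : forall i x v, x \in W i ->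
  16 * l * #|[set p : {perm V} | (p x == v) && bad i p]| <= (#|V|.-1)`!.

Definition all_good : {set {perm V}} := [set p : {perm V} | [forall i, ~~ bad i p]].

Let values i (p : {perm V}) := [seq p x | x <- enum (W i)].
(** A bad window is split into elementary events, one for each list of values that a bad permutation
    gives to [W i]; [undup] keeps each list once. *)
Let bads i := undup [seq values i p | p <- enum (bad i)].
Let F := flatten [seq [seq (enum (W i), vs) | vs <- bads i] | i <- enum 'I_N].

Let F_P B : reflect (exists2 i, B.1 = enum (W i) & exists2 p, bad i p & B.2 = values i p) (B \in F).
Proof.
apply: (iffP flatten_mapP) => [[i _ /mapP[vs]]|[i B1 [p bp B2]]].
  rewrite mem_undup => /mapP[p]; rewrite mem_enum => bp -> ->.
  by exists i => //; exists p.
exists i; rewrite ?mem_enum //; apply/mapP; exists (values i p).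
  by rewrite mem_undup map_f ?mem_enum.
by rewrite -B1 -B2 -surjective_pairing.
Qed.

Let avoidsF : avoids F = all_good.
Proof.
apply/setP => p; rewrite !inE; apply/idP/forallP => [h i|h].
  apply: contra h => bp; apply/hasP; exists (enum (W i), values i p); last by rewrite inE.
  by apply/F_P; exists i => //; exists p.
apply/hasP => -[B /F_P[i B1 [p' bp' B2]]]; rewrite inE B1 B2 => /eqP E.
have /negP := h i; apply; rewrite (bad_local (p' := p')) // => x xW.
by move/eq_in_map: E => -> //; rewrite mem_enum.
Qed.

Let weight i z := \sum_(vs <- bads i | hits (enum (W i), vs) z) #|extends (enum (W i)) vs|.

Let sum_F z : \sum_(B <- F | hits B z) #|extends B.1 B.2| = \sum_i weight i z.
Proof.
rewrite /F big_flatten /= big_map enumT; apply: eq_bigr => i _.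
by rewrite big_map.
Qed.

(** A permutation lies in the event of a single value list, its own [values i p], and by [bad_local]
    it is then bad itself. *)
Let weight_le i z :
  weight i z <= #|[set p | bad i p && hits (enum (W i), values i p) z]|.
Proof.
rewrite /weight.
have E vs : #|extends (enum (W i)) vs| = \sum_(p : {perm V}) (values i p == vs).
  by rewrite -sum1dep_card big_mkcond; apply: eq_bigr => p _; rewrite /values; case: eqP.
rewrite (eq_bigr _ (fun vs _ => E vs)) exchange_big /= -sum1dep_card [X in _ <= X]big_mkcond /=.
apply: leq_sum => p _.
rewrite (eq_bigr (fun vs => if values i p == vs then 1 else 0)); last by move=> vs _; case: eqP.
rewrite -big_mkcondr /= sum1_count.
set c := count _ _; have c1 : c <= count_mem (values i p) (bads i).
  by apply: sub_count => vs /= /andP[_ /eqP ->].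
have c2 : count_mem (values i p) (bads i) <= 1 by rewrite count_uniq_mem ?undup_uniq ?leq_b1.
case: ifP => [_|/negP h]; first exact: leq_trans c1 c2.
rewrite leqNgt; apply/negP; rewrite /c -has_count => /hasP[vs vsb /= /andP[hz /eqP E']].
apply: h; rewrite E' hz andbT.
move: vsb; rewrite mem_undup => /mapP[p']; rewrite mem_enum => bp' E''.
rewrite (bad_local (p' := p')) // => x xW.
by move: E'; rewrite E'' => /eq_in_map -> //; rewrite mem_enum.
Qed.

Let fact_sum : \sum_(v : V) (#|V|.-1)`! = #|V|`! \/ #|V| = 0.
Proof.
case: (posnP #|V|) => [|V0]; [by right | left].
by rewrite sum_nat_const -[in RHS](prednK V0) factS prednK.
Qed.

(** For a position [x], [bad_rare] is summed over the values of [x]; for a value [v], over the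
    positions sent to [v]. The factor between 8 and 16 pays for the two windows that can contain a
    position. *)
Let sparse z : 8 * l * (\sum_(B <- F | hits B z) #|extends B.1 B.2|) <= #|V|`!.
Proof.
have V0 : 0 < #|V| by apply/card_gt0P; case: z => y; exists y.
have fs : \sum_(v : V) (#|V|.-1)`! = #|V|`! by case: fact_sum V0 => // ->.
rewrite sum_F big_distrr /= -(leq_pmul2l (ltn0Sn 1)) big_distrr /=.
case: z => [x|v].
  apply: (@leq_trans (\sum_i (x \in W i) * #|V|`!)); last first.
    by rewrite -big_distrl /= leq_mul2r W_deg orbT.
  apply: leq_sum => i _; rewrite !mulnA.
  case: (boolP (x \in W i)) => xW; last first.
    rewrite mul0n leqn0 muln_eq0 /weight big1 ?eqxx ?orbT // => vs.
    by rewrite /= mem_enum (negPf xW).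
  rewrite mul1n; apply: leq_trans (leq_mul (leqnn _) (weight_le i _)) _.
  rewrite -fs -sum1dep_card (partition_big (fun p : {perm V} => p x) xpredT) //=.
  rewrite big_distrr /=; apply: leq_sum => v _; apply: leq_trans (bad_rare v xW).
  rewrite leq_mul2l; apply/orP; right; rewrite sum1dep_card.
  by apply/subset_leq_card/subsetP => p; rewrite !inE => /andP[/andP[-> _] ->].
apply: (@leq_trans (\sum_(x : V) \sum_i (x \in W i) * (#|V|.-1)`!)); last first.
  rewrite -fs big_distrr; apply: leq_sum => x _.
  by rewrite -big_distrl /= leq_mul2r W_deg orbT.
rewrite exchange_big /=; apply: leq_sum => i _; rewrite !mulnA.
apply: leq_trans (leq_mul (leqnn _) (weight_le i _)) _.
apply: (@leq_trans (2 * 8 * l * \sum_(x in W i) #|[set p : {perm V} | (p x == v) && bad i p]|)).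
  rewrite leq_mul2l; apply/orP; right.
  apply: (@leq_trans #|\bigcup_(x in W i) [set p : {perm V} | (p x == v) && bad i p]|).
    apply/subset_leq_card/subsetP => p; rewrite inE /= => /andP[bp /mapP[x]].
    by rewrite mem_enum => xW E; apply/bigcupP; exists x => //; rewrite inE -E eqxx.
  elim/big_rec2: _ => [|x n A _ h]; first by rewrite cards0.
  by apply: leq_trans (leq_card_setU _ _) _; rewrite leq_add2l.
rewrite big_distrr /= [X in X <= _]big_mkcond /=; apply: leq_sum => x _.
by case: ifP => // xW; rewrite mul1n bad_rare.
Qed.

Let uF B : B \in F -> uniq B.1.
Proof. by case/F_P => i -> _; apply: enum_uniq. Qed.
Let s1F B : B \in F -> size B.1 = size B.2.
Proof. by case/F_P => i -> [p _ ->]; rewrite size_map. Qed.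
Let sF B : B \in F -> size B.1 <= l.
Proof. by case/F_P => i -> _; rewrite -cardE. Qed.

Lemma all_good_gt0 : 0 < #|all_good|.
Proof.
rewrite -avoidsF; apply: (avoids_gt0 uF s1F sF l_gt0 sparse) => B /F_P[i -> _].
by rewrite -cardE card_gt0.
Qed.

Lemma all_good_spread ps vs : uniq ps -> uniq vs -> size ps = size vs ->
  #|extends ps vs :&: all_good| * #|V| ^_ (size ps) <= 4 ^ size ps * #|all_good|.
Proof. by move=> *; rewrite -avoidsF; apply: (local_lemma_spread uF s1F sF l_gt0 sparse). Qed.

End Windows.

(** * Counting placements of edges in windows *)

Section Words.
Variable T : eqType.

Fixpoint words j (s : seq T) : seq (seq T) :=
  if j is j'.+1 then [seq y :: w | y <- s, w <- words j' s] else [:: [::]].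

Lemma size_words j s : size (words j s) = size s ^ j.
Proof. by elim: j => [|j IH] /=; [rewrite expn0 | rewrite size_allpairs IH expnS]. Qed.

Lemma mem_words j s w : size w = j -> all (mem s) w -> w \in words j s.
Proof.
elim: j w => [|j IH] [|y w] //= [sz] /andP[ys ws].
by apply/allpairsP; exists (y, w); rewrite IH.
Qed.
End Words.

(** Induction with [(1 + 1/n)^j <= expR (j/n) <= expR 1] for [j <= n]. The loss is constant per
    factor even at [j = n], which matters when the given edges cover almost all vertices. *)
Lemma exp_le_ffact (R : realType) n j : j <= n ->
  ((n%:R : R) ^+ j <= expR 1 ^+ j * (n ^_ j)%:R)%R.
Proof.
elim: j n => [|j IH] [|n] // jn; rewrite ?expr0 ?ffactn0 ?mulr1 //.
rewrite ffactSS natrM exprS [X in (_ <= X)%R]mulrCA ler_wpM2l // exprS -mulrA.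
case: n => [|n] in jn *.
  case: j {IH} jn => // _.
  by rewrite !expr0 ffactn0 !mulr1; apply: le_trans (expR_ge1Dx _); rewrite lerDl.
apply: le_trans (ler_wpM2l (expR_ge0 1) (IH _ jn)).
have n0 : (0 < n.+1%:R :> R)%R by rewrite ltr0n.
rewrite -ler_pdivrMr ?exprn_gt0 // -expr_div_n.
have le1 : (n.+2%:R / n.+1%:R <= expR (n.+1%:R^-1) :> R)%R.
  by apply: le_trans (expR_ge1Dx _); rewrite -addn1 natrD mulrDl mul1r divff ?gt_eqF.
apply: (@le_trans _ _ (expR (n.+1%:R^-1) ^+ j)%R).
  by rewrite lerXn2r ?nnegrE ?divr_ge0 ?expR_ge0.
rewrite -expRM_natr ler_expR mulrC ler_pdivrMr // mul1r ler_nat //.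
Qed.

Section SpreadCount.
Variables (V : finType) (N l k : nat) (W : 'I_N -> {set V}) (G : {set {perm V}}).
Hypothesis k_gt0 : 0 < k.
Hypothesis W_le : forall i, #|W i| <= l.
Hypothesis W_deg : forall x, \sum_i (x \in W i) <= 2.
Hypothesis G_spread : forall ps vs, uniq ps -> uniq vs -> size ps = size vs ->
  #|extends ps vs :&: G| * #|V| ^_ (size ps) <= 4 ^ size ps * #|G|.

Let near x : {set V} := \bigcup_(i | x \in W i) W i.

Let card_near x : #|near x| <= 2 * l.
Proof.
apply: (@leq_trans (\sum_i (x \in W i) * l)); last by rewrite -big_distrl leq_mul2r W_deg orbT.
rewrite /near big_mkcond; elim/big_rec2: _ => [|i n A _ h]; first by rewrite cards0.
apply: leq_trans (leq_card_setU _ _) _; apply: leq_add => //.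
by case: ifP => _; rewrite ?cards0 // mul1n.
Qed.

(** An edge inside a window is located by the position of its first vertex and [k - 1] further
    positions in the at most two windows around it. *)
Let chunks : seq (seq V) := flatten [seq [seq x :: w | w <- words k.-1 (enum (near x))] | x <- enum V].

Let size_chunks : size chunks <= #|V| * (2 * l) ^ k.-1.
Proof.
rewrite /chunks size_flatten /shape -map_comp sumnE big_map.
rewrite big_enum /= -sum_nat_const; apply: leq_sum => x _.
by rewrite /= size_map size_words -cardE; case: k.-1 => // j; rewrite leq_exp2r.
Qed.

(* The possible lists of positions of the vertices of t disjoint edges, each of
   them inside one window. *)
Fixpoint layouts t : seq (seq V) :=
  if t is t'.+1 then [seq c ++ ps | c <- chunks, ps <- layouts t'] else [:: [::]].

Let size_layouts t : size (layouts t) <= (#|V| * (2 * l) ^ k.-1) ^ t.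
Proof. by elim: t => [|t IH] /=; [rewrite expn0 | rewrite size_allpairs expnS leq_mul]. Qed.

Let layout_mem (es : seq {set V}) (p : {perm V}) :
  (forall e, e \in es -> #|e| = k /\ exists i, e \subset p @: W i) ->
  [seq (p^-1)%g y | y <- flatten [seq enum e | e : {set V} <- es]] \in layouts (size es).
Proof.
elim: es => [|e es IH] h //=; rewrite map_cat; apply/allpairsP.
exists ([seq (p^-1)%g y | y <- enum e], [seq (p^-1)%g y | y <- flatten [seq enum e | e : {set V} <- es]]).
split=> //=; last by apply: IH => e' e'es; apply: h; rewrite inE e'es orbT.
have [ek [i eW]] := h e (mem_head _ _).
have eW' y : y \in enum e -> (p^-1)%g y \in W i.
  rewrite mem_enum => /(subsetP eW)/imsetP[x xW ->]; by rewrite permK.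
case E : (enum e) eW' => [|y ys] eW' /=.
  by move: ek k_gt0; rewrite cardE E => <-.
have yW : (p^-1)%g y \in W i by apply: eW'; rewrite mem_head.
apply/flatten_mapP; exists ((p^-1)%g y); first by rewrite mem_enum.
apply/map_f/mem_words; first by rewrite size_map -ek cardE E.
apply/allP => _ /mapP[z zys ->]; rewrite /= mem_enum; apply/bigcupP; exists i => //.
by apply: eW'; rewrite inE zys orbT.
Qed.

(** When all edges of [E] lie in images of windows, the positions of their vertices form one of the
    [layouts]; a union bound over these is combined with [G_spread]. *)
Lemma spread_count (E : {set {set V}}) :
  (forall e, e \in E -> #|e| = k) -> trivIset E ->
  #|[set p in G | [forall e in E, [exists i, e \subset p @: W i]]]| * #|V| ^_ (k * #|E|)
    <= (#|V| * (2 * l) ^ k.-1) ^ #|E| * (4 ^ (k * #|E|) * #|G|).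
Proof.
move=> Ek tE; set A := [set p in G | _].
pose vs := flatten [seq enum e | e : {set V} <- enum E].
have h_in e : e \in enum E -> #|e| = k by rewrite mem_enum; apply: Ek.
have svs : size vs = k * #|E|.
  rewrite cardE /vs; elim: (enum E) h_in => [|e es IH] h /=; first by rewrite muln0.
  rewrite size_cat -cardE (h e) ?mem_head // mulnS IH // => e' e'es.
  by apply: h; rewrite inE e'es orbT.
have uvs : uniq vs.
  have := enum_uniq E; have : {subset enum E <= E} by move=> e; rewrite mem_enum.
  rewrite /vs; elim: (enum E) => //= e es IH sub /andP[ees ues].
  rewrite cat_uniq enum_uniq IH ?andbT //; last by move=> e' e'es; apply: sub; rewrite inE e'es orbT.
  apply/hasP => -[x /flatten_mapP[e' e'es]]; rewrite !mem_enum => xe' xe.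
  have ne : e != e' by apply: contraNneq ees => ->.
  have := trivIsetP tE _ _ (sub e (mem_head _ _)) (sub e' _) ne.
  rewrite inE e'es orbT => /(_ isT)/pred0P/(_ x); by rewrite /= xe xe'.
have sub : A \subset \bigcup_(i < size (layouts #|E|)) (extends (nth [::] (layouts #|E|) i) vs :&: G).
  apply/subsetP => p; rewrite inE => /andP[pG /forall_inP hp].
  have := @layout_mem (enum E) p; rewrite -cardE => /(_ _)/(nthP [::]) [|i il hi].
    move=> e eE; split; first exact: h_in.
    by move: eE; rewrite mem_enum => /hp/existsP.
  apply/bigcupP; exists (Ordinal il) => //; rewrite inE pG andbT inE /= hi -map_comp.
  by rewrite (eq_map (g := id)) ?map_id // => y /=; rewrite permKV.
have one i : #|extends (nth [::] (layouts #|E|) i) vs :&: G| * #|V| ^_ (k * #|E|) <= 4 ^ (k * #|E|) * #|G|.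
  set ps := nth _ _ _.
  (* A layout may have repetitions, and then the count is 0. If some permutation sends it to [vs],
     it has the length of [vs] and no repetitions, as [G_spread] requires. *)
  case: (posnP #|extends ps vs|) => [e0|/card_gt0P[p]].
    rewrite (_ : #|_ :&: _| = 0) //; apply/eqP; rewrite -leqn0 -e0.
    by rewrite subset_leq_card ?subsetIl.
  rewrite inE => /eqP pvs; have sz : size ps = size vs by rewrite -pvs size_map.
  have ups : uniq ps by move: uvs; rewrite -pvs => /map_uniq.
  by have := G_spread ups uvs sz; rewrite sz svs.
apply: (@leq_trans (size (layouts #|E|) * (4 ^ (k * #|E|) * #|G|))); last first.
  by rewrite leq_mul2r size_layouts orbT.
apply: (@leq_trans (\sum_(i < size (layouts #|E|)) #|extends (nth [::] (layouts #|E|) i) vs :&: G| * #|V| ^_ (k * #|E|))).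
  rewrite -big_distrl /= leq_mul2r; apply/orP; right.
  apply: leq_trans (subset_leq_card sub) _.
  elim/big_rec2: _ => [|x n B _ h]; first by rewrite cards0.
  by apply: leq_trans (leq_card_setU _ _) _; rewrite leq_add2l.
rewrite -[X in _ <= X * _]card_ord -sum_nat_const; exact: leq_sum.
Qed.
End SpreadCount.

(** * Poor windows are rare *)

(** A division-free form of [(n-1)...(n-j) / n^j >= 1 - j^2/n]. *)
Lemma ffact_ge n j : n ^ j * (n - j * j) <= n * n.-1 ^_ j.
Proof.
elim: j => [|j IH]; first by rewrite expn0 ffactn0; lia.
have [le|gt] := leqP n (j.+1 * j.+1).
  by rewrite (eqP (_ : n - j.+1 * j.+1 == 0)) ?muln0 // subn_eq0.
rewrite ffactnSr mulnA; apply: leq_trans (leq_mul IH (leqnn _)).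
rewrite expnSr -!mulnA leq_mul2l; apply/orP; right; clear IH; nia.
Qed.

Lemma ffact_le_expn n j : n ^_ j <= n ^ j.
Proof.
elim: j => [|j IH]; first by rewrite ffactn0.
by rewrite ffactnSr expnSr leq_mul // leq_subr.
Qed.

Lemma bin_le_add a c r : 'C(a + c, r.+1) <= 'C(a, r.+1) + c * 'C((a + c).-1, r).
Proof.
elim: c => [|c IH]; first by rewrite addn0 mul0n addn0.
rewrite addnS /= binS mulSn addnCA addnC leq_add2l.
by apply: leq_trans IH _; rewrite leq_add2l leq_mul2l leq_bin2l ?orbT // leq_pred.
Qed.

Lemma bin_shrink (R : realType) a b r (xi : R) : (0 < r)%N -> a <= b -> (0 < b)%N ->
  (((b - a) * r)%:R <= xi * b%:R)%R ->
  ((1 - xi) * 'C(b, r)%:R <= 'C(a, r)%:R :> R)%R.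
Proof.
case: r => // r _ ab b0 hxi; have b0R : (0 < b%:R :> R)%R by rewrite ltr0n.
have := bin_le_add a (b - a) r; rewrite subnKC // -(ler_nat R) natrD => h.
suff : (((b - a) * 'C(b.-1, r))%:R <= xi * 'C(b, r.+1)%:R :> R)%R by lra.
rewrite -(ler_pM2l b0R) -natrM mulnCA mul_bin_diag mulnA natrM mulrA.
by rewrite [(_ * xi)%R]mulrC ler_wpM2r.
Qed.

(** The price of replacing [j] values of a permutation by independent samples: the bound [1 - j^2/n]
    from [ffact_ge] is at least 1/2. *)
Lemma fact_drop_le n j : (0 < n) -> 2 * (j * j) <= n -> n ^ j * (n.-1 - j)`! <= 2 * (n.-1)`!.
Proof.
move=> n0 jn.
have jn1 : j <= n.-1 by case: j jn => [|j]; nia.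
rewrite -(ffact_fact jn1) mulnA leq_mul2r; apply/orP; right.
rewrite -(leq_pmul2l n0); have := ffact_ge n j; move: (n ^ j) (_ ^_ _) => a b h.
have : n * a <= 2 * (a * (n - j * j)) by clear -jn; nia.
by clear -h; nia.
Qed.

Section PoorWindows.
Variables (R : realType) (V : finType) (H : {set {set V}}) (d k : nat) (q rho lambda : R).
Hypotheses (uH : uniform k H) (dk : 0 < d < k).
Implicit Types (S D W X : {set V}) (x v : V).
Let n := #|V|.
Let r := k - d.

Definition few S X : bool := (#|link_in H S X|%:R < q * 'C(#|X|, r)%:R)%R.

Definition poor W X : bool :=
  [exists S : {set V}, [&& S \subset W, #|S| == d & few S X]].

Lemma rich_not_poor W X : ~~ poor W X -> rich H d k q W X.
Proof.
move=> /existsPn h S SW /eqP Sd; have := h S; rewrite SW Sd /=.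
by rewrite -leNgt.
Qed.

Hypothesis lambda01 : (0 < lambda <= 1)%R.
Hypothesis deg_ge : forall S, #|S| = d -> (rho * n%:R ^+ r <= (r`! * degree H S)%:R)%R.

(** The bound of [sampling] for a block of size [b], of which up to [d.+1] positions are not
    sampled: a fixed one and those of a [d]-set. *)
Definition tail (b : nat) : R := expR (- (lambda ^+ 2 / (8 * r%:R ^+ 2) * (b - d.+1)%:R)).

(** With [p x = v] fixed, the images of [D] are revealed first and determine the [d]-set whose link
    is tested; the rest [A] of [X] then samples this link, which has density at least [rho]. Passing
    to independent samples costs the factor 2. *)
Lemma few_rare x v D W X : #|D| = d -> D \subset W -> X \subset W -> x \in W ->
  2 * (#|W| * #|W|) <= n -> d + r < #|X| ->
  (forall a, #|X| - d.+1 <= a <= #|X| ->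
    (q * 'C(#|X|, r)%:R <= (rho - lambda) * 'C(a, r)%:R)%R) ->
  (#|[set p : {perm V} | (p x == v) && few (p @: D) (p @: X)]|%:R <=
     2 * (n.-1)`!%:R * tail #|X| :> R)%R.
Proof.
move=> Dd DW XW xW Wn rX hq.
have n0 : 0 < n by apply/card_gt0P; exists x.
pose A := X :\: (x |: D); pose D' := D :\ x.
pose ps := enum D' ++ enum A.
have xA : x \notin A by rewrite !inE eqxx.
have xD' : x \notin D' by rewrite !inE eqxx.
have dDA : [disjoint D' & A].
  by rewrite -setI_eq0; apply/eqP/setP => y; rewrite !inE; case: (y == x); case: (y \in D); rewrite ?andbF.
have ups : uniq ([:: x] ++ ps).
  rewrite cat1s cons_uniq mem_cat !mem_enum negb_or xD' xA /=.
  rewrite /ps cat_uniq !enum_uniq andbT andTb.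
  apply/hasP => -[y yA yD]; move: yA yD; rewrite /= !mem_enum => yA yD.
  by have /pred0P/(_ y) := dDA; rewrite /= yA yD.
have sps : size ps = #|D'| + #|A| by rewrite size_cat -!cardE.
have psW : size ps <= #|W|.
  rewrite sps -cardsUI disjoint_setI0 // cards0 addn0; apply: subset_leq_card.
  rewrite subUset; apply/andP; split; apply: subset_trans (subsetDl _ _) _ => //.
have Ab : #|X| - d.+1 <= #|A| <= #|X|.
  rewrite subset_leq_card ?subsetDl // andbT cardsD leq_sub2l //.
  apply: leq_trans (subset_leq_card (subsetIr _ _)) _; rewrite cardsU1 Dd.
  by case: (x \notin D).
have rA : r <= #|A| by case/andP: Ab => A1 _; apply: leq_trans A1; clear -rX; lia.
(* The position [x] is not sampled, so [v] is added by hand when [x] lies in [D]. Independent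
   samples may coincide, hence the size test in [ev], which gives access to [deg_ge]. *)
pose Sof (w : seq V) : {set V} := [set y in take #|D'| w] :|: (if x \in D then [set v] else set0).
pose ev (w : seq V) := (#|Sof w| == d) &&
  ((subcount (drop #|D'| w) r (link H (Sof w)))%:R < q * 'C(#|X|, r)%:R :> R)%R.
pose Phi (w : seq V) : R := (ev w)%:R%R.
have step p : p \in extends [:: x] [:: v] -> few (p @: D) (p @: X) -> ev [seq p y | y <- ps].
  rewrite inE /= => /eqP[pxv] hfew.
  have sD' : size [seq p y | y <- enum D'] = #|D'| by rewrite size_map -cardE.
  have SE : Sof [seq p y | y <- ps] = p @: D.
    rewrite /Sof /ps map_cat -sD' take_size_cat //.
    apply/setP => y; rewrite !inE; apply/orP/imsetP.
      case=> [/mapP[z]|].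
        by rewrite mem_enum => /setD1P[_ zD] ->; exists z.
      by case: ifP => xD; rewrite ?inE // => /eqP ->; exists x.
    move=> [z zD ->]; case: (eqVneq z x) => [zx|zx].
      by right; rewrite -zx zD inE zx pxv.
    by left; apply: map_f; rewrite mem_enum !inE zx.
  have cD : #|p @: D| = d by rewrite card_imset //; apply: perm_inj.
  have cX : #|p @: X| = #|X| by rewrite card_imset //; apply: perm_inj.
  rewrite /ev SE cD eqxx /=; move: hfew; rewrite /few cX; apply: le_lt_trans.
  rewrite ler_nat /ps map_cat -sD' drop_size_cat //.
  apply: leq_trans (subcount_le _ _ _) _.
    by rewrite map_inj_uniq ?enum_uniq //; apply: perm_inj.
  apply/subset_leq_card/subsetP => T; rewrite !inE => /andP[-> /andP[_ TA]] /=.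
  apply: subset_trans TA _; apply/subsetP => _ /mapP[z + ->].
  by rewrite mem_enum => /setDP[zX _]; apply: imset_f.
have le1 : (#|[set p : {perm V} | (p x == v) && few (p @: D) (p @: X)]|%:R <=
    \sum_(p in extends [:: x] [:: v]) Phi [seq (p : {perm V}) y | y <- ps] :> R)%R.
  rewrite -sum1_card natr_sum [X in (_ <= X)%R]big_mkcond [X in (X <= _)%R]big_mkcond /=.
  apply: ler_sum => p _; have := step p; rewrite !inE /= eqseq_cons andbT.
  case: (p x == v) => //= /(_ isT); case: (few _ _) => [/(_ isT)|_]; last by case: (ev _).
  by rewrite /Phi => ->.
apply: le_trans le1 _.
have Phi0 w : (0 <= Phi w)%R by rewrite /Phi ler0n.
have sz1 : size [:: x] = size [:: v] by [].
apply: le_trans (sum_extends_le ups sz1 Phi0) _.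
have szn : (size ps <= n.-1)%N.
  have := max_card (mem ([:: x] ++ ps)); rewrite (card_uniqP ups) /=.
  by rewrite /n; case: #|V|.
have bound : (seqsum (size ps) Phi <= n%:R ^+ size ps * tail #|X|)%R.
  rewrite sps seqsum_cat exprD.
  apply: (@le_trans _ _ (seqsum #|D'| (fun=> n%:R ^+ #|A| * tail #|X|))%R).
    apply: ler_seqsum => u su; rewrite /Phi /ev.
    have Su s : Sof (u ++ s) = Sof u by rewrite /Sof -su take_size_cat // take_size.
    case: (eqVneq #|Sof u| d) => [Sd|nS]; last first.
      rewrite (eq_seqsum (G' := fun=> 0%R)); last by move=> s _; rewrite Su (negPf nS).
      by rewrite seqsum_const mulr0 mulr_ge0 ?exprn_ge0 // expR_ge0.
    rewrite (eq_seqsum (G' := fun s => (((subcount s r (link H (Sof u)))%:R < q * 'C(#|X|, r)%:R)%R%:R)%R)); last first.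
      by move=> s _; rewrite Su Sd eqxx -su drop_size_cat.
    pose G' s : R := (((subcount s r (link H (Sof u)))%:R < (rho - lambda) * 'C(#|A|, r)%:R)%R%:R)%R.
    apply: (@le_trans _ _ (seqsum #|A| G')).
      apply: ler_seqsum => s _; rewrite /G' ler_nat; case: ltP => // h.
      by rewrite (lt_le_trans h (hq _ Ab)).
    apply: le_trans (sampling n0 _ _ lambda01 _) _.
    - by rewrite rA andbT subn_gt0; case/andP: dk.
    - by move=> e /(link_card uH); rewrite Sd.
    - by rewrite card_link deg_ge.
    rewrite ler_wpM2l ?exprn_ge0 // ler_expR lerN2.
    rewrite ler_wpM2l ?ler_nat; first by [].
      by rewrite divr_ge0 ?mulr_ge0 ?exprn_ge0 //; case/andP: lambda01 => /ltW.
    by case/andP: Ab.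
  by rewrite seqsum_const mulrA.
rewrite [(2 * _)%R]mulrC -[(_ * 2)%R]mulrC /=.
apply: le_trans (ler_wpM2l _ bound) _; first exact: ler0n.
rewrite mulrA ler_wpM2r ?expR_ge0 // -natrX -!natrM ler_nat subn1 mulnC.
apply: fact_drop_le => //; apply: leq_trans Wn; rewrite leq_mul2l leq_mul //.
Qed.

(** A deficient set in [p @: W] is the image of one of at most [#|W| ^ d] sets of positions, and
    [few_rare] applies to each. *)
Lemma poor_rare x v W X : X \subset W -> x \in W ->
  2 * (#|W| * #|W|) <= n -> d + r < #|X| ->
  (forall a, #|X| - d.+1 <= a <= #|X| ->
    (q * 'C(#|X|, r)%:R <= (rho - lambda) * 'C(a, r)%:R)%R) ->
  (#|[set p : {perm V} | (p x == v) && poor (p @: W) (p @: X)]|%:R <=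
     #|W|%:R ^+ d * (2 * (n.-1)`!%:R * tail #|X|) :> R)%R.
Proof.
move=> XW xW Wn rX hq.
pose Ds := [set D : {set V} | D \subset W & #|D| == d].
apply: (@le_trans _ _ (\sum_(D in Ds) #|[set p : {perm V} | (p x == v) && few (p @: D) (p @: X)]|%:R)%R).
  rewrite -natr_sum ler_nat.
  apply: (@leq_trans #|\bigcup_(D in Ds) [set p : {perm V} | (p x == v) && few (p @: D) (p @: X)]|).
    apply/subset_leq_card/subsetP => p; rewrite inE => /andP[pxv /existsP[S /and3P[SW Sd fS]]].
    have SE : p @: (p @^-1: S) = S.
      apply/setP => y; apply/imsetP/idP => [[z]|yS]; first by rewrite inE => ? ->.
      by exists ((p^-1)%g y); rewrite ?inE ?permKV.
    apply/bigcupP; exists (p @^-1: S); last by rewrite inE pxv SE.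
    rewrite inE -(card_imset _ (@perm_inj _ p)) SE Sd andbT.
    by apply/subsetP => y; rewrite inE => /(subsetP SW)/imsetP[z zW /perm_inj ->].
  elim/big_rec2: _ => [|D m A _ h]; first by rewrite cards0.
  by apply: leq_trans (leq_card_setU _ _) _; rewrite leq_add2l.
apply: (@le_trans _ _ (\sum_(D in Ds) (2 * (n.-1)`!%:R * tail #|X|))%R).
  by apply: ler_sum => D; rewrite inE => /andP[DW /eqP Dd]; apply: (few_rare v Dd DW XW xW Wn rX hq).
rewrite sumr_const -[X in (X <= _)%R]mulr_natl ler_wpM2r ?mulr_ge0 ?expR_ge0 //.
rewrite cards_draws -natrX ler_nat.
apply: (@leq_trans ('C(#|W|, d) * d`!)); first by rewrite leq_pmulr ?fact_gt0.
by rewrite bin_ffact ffact_le_expn.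
Qed.
End PoorWindows.

(** * The spread measure *)

(** The enumeration of [V] is cut after every [m] vertices; the minimum in [g] lets the last block
    swallow the remainder, which is smaller than [m]. *)
Lemma exists_blocks (V : finType) m : 0 < m <= #|V| ->
  exists l (b : V -> nat), [/\ 0 < l, forall x, b x < l
    & forall i, i < l -> m <= #|[set x | b x == i]| <= 2 * m].
Proof.
move=> /andP[m0 mn]; set n := #|V| in mn *; pose l := n %/ m.
have l0 : 0 < l by rewrite divn_gt0.
pose g (j : nat) := minn (j %/ m) l.-1.
exists l, (fun x => g (enum_rank x)); split=> // [x|i il].
  by rewrite /g gtn_min ltn_predL l0 orbT.
have E : #|[set x : V | g (enum_rank x) == i]| = #|[set j : 'I_n | g j == i]|.
  rewrite -(card_imset _ (@enum_rank_inj V)); apply: eq_card => j.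
  rewrite inE; apply/imsetP/idP => [[x]|gj]; first by rewrite inE => + ->.
  by exists (enum_val j); rewrite ?inE ?enum_valK.
have lm : l * m <= n by apply: leq_trunc_div.
have nlm : n < l.+1 * m by rewrite mulSnr {1}(divn_eq n m) ltn_add2l ltn_pmod.
rewrite E; apply/andP; split.
  have hj (t : 'I_m) : i * m + t < n.
    apply: leq_trans lm; have := ltn_ord t; move: il; move: (nat_of_ord t) => t'.
    clear; nia.
  have jI : injective (fun t => Ordinal (hj t)).
    by move=> s t [] /addnI /val_inj.
  rewrite -[m in X in X <= _]card_ord -(card_imset _ jI).
  apply/subset_leq_card/subsetP => _ /imsetP[t _ ->]; rewrite inE /g /=.
  by rewrite divnMDl // divn_small // addn0 (minn_idPl _) // -ltnS prednK.
have hj j : j \in [set j : 'I_n | g j == i] -> i * m <= j < i * m + 2 * m.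
  rewrite inE /g => /eqP gi; have jn := ltn_ord j.
  have [le|gt] := leqP (j %/ m) l.-1.
    rewrite (minn_idPl le) in gi; have := divn_eq j m; have := ltn_pmod j m0.
    by rewrite gi; clear -m0; lia.
  rewrite (minn_idPr (ltnW gt)) in gi.
  have := leq_trunc_div j m; move: gt nlm; rewrite -gi; clear -l0 jn m0.
  case: l l0 => // l _ /=; nia.
pose h (j : 'I_n) := inord (j - i * m) : 'I_(2 * m).-1.+1.
have m2 : (2 * m).-1.+1 = 2 * m by rewrite prednK // muln_gt0.
rewrite -[2 * m in X in _ <= X]m2 -[X in _ <= X]card_ord.
rewrite -(@card_in_imset _ _ h (mem [set j : 'I_n | g j == i])); first exact: max_card.
move=> j1 j2 /hj/andP[a1 b1] /hj/andP[a2 b2] /(congr1 val).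
rewrite /h /= !inordK ?m2; [|clear -a2 b2; lia|clear -a1 b1; lia].
by move=> e; apply: val_inj => /=; clear -e a1 a2; lia.
Qed.

Lemma sum_eq_le1 l c : \sum_(i < l) (c == i :> nat) <= 1.
Proof.
have [cl|lc] := ltnP c l.
  rewrite (bigD1 (Ordinal cl)) //= eqxx big1 // => i; rewrite -val_eqE /= eq_sym.
  by case: eqP.
by rewrite big1 // => i _; case: eqP => // E; have := ltn_ord i; rewrite -E ltnNge lc.
Qed.

(** The exponential is the [j.+1]-st power of a number that is at least [beta * m] once [m >= 2c];
    the one power of [m] beyond [m^j] absorbs [A]. *)
Lemma natpow_le_expR (R : realType) (A kappa : R) c j : (0 < kappa)%R -> (0 <= A)%R ->
  exists m0, forall m, m0 <= m -> (A * m%:R ^+ j <= expR (kappa * (m - c)%:R))%R.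
Proof.
move=> kappa0 A0; pose beta : R := (kappa / (2 * j.+1%:R))%R.
have b0 : (0 < beta)%R by rewrite divr_gt0 // mulr_gt0 // ltr0n.
pose m1 := Num.bound (A / beta ^+ j.+1)%R.
exists (maxn m1 (2 * c)) => m; rewrite geq_max => /andP[mm1 mc].
have hm : (A <= beta ^+ j.+1 * m%:R)%R.
  rewrite mulrC -ler_pdivrMr ?exprn_gt0 //.
  apply: le_trans (_ : m1%:R <= _)%R; last by rewrite ler_nat.
  by apply/ltW/archi_boundP; rewrite divr_ge0 // exprn_ge0 // ltW.
have hc : (m%:R <= 2 * (m - c)%:R :> R)%R.
  by rewrite -natrM ler_nat; clear -mc; lia.
set y := (kappa * (m - c)%:R)%R.
have -> : expR y = (expR (y / j.+1%:R) ^+ j.+1)%R.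
  by rewrite -expRM_natr divfK // pnatr_eq0.
have yb : (beta * m%:R <= expR (y / j.+1%:R))%R.
  apply: le_trans (_ : y / j.+1%:R <= _)%R; last first.
    by apply: le_trans (expR_ge1Dx (y / j.+1%:R)%R); rewrite lerDr ler01.
  rewrite /beta /y ler_pdivlMr ?ltr0n // mulrAC.
  rewrite (_ : (kappa / (2 * j.+1%:R) * j.+1%:R = kappa / 2)%R); last first.
    by rewrite invfM mulrA divfK ?pnatr_eq0.
  by rewrite -mulrA ler_pM2l // mulrC ler_pdivrMr // mulrC.
apply: le_trans (_ : (beta * m%:R) ^+ j.+1 <= _)%R; last first.
  by rewrite lerXn2r ?nnegrE ?expR_ge0 // mulr_ge0 // ltW.
rewrite exprMn [(m%:R ^+ j.+1)%R]exprS mulrA ler_wpM2r ?exprn_ge0 //.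
Qed.

Lemma spread_arith (R : realType) (n c g k t : nat) (e : R) : 0 < n -> 0 < k ->
  (e ^+ (k * t) * ((n * c ^ k.-1) ^ t * (4 ^ (k * t) * g))%:R =
   n%:R ^+ (k * t) * ((c%:R ^+ k.-1 * (4 * e) ^+ k / n%:R ^+ k.-1) ^+ t * g%:R))%R.
Proof.
move=> n0; case: k => // k _; have nR : (n%:R != 0 :> R)%R by rewrite pnatr_eq0 -lt0n.
rewrite !natrM !natrX natrM natrX !exprM !mulrA -!exprMn; congr (_ ^+ t * _)%R.
by rewrite !exprS !exprMn /=; field; rewrite expf_neq0.
Qed.

(** * The measure induced by a uniform good permutation *)

Section Measure.
Variables (R : realType) (V : finType) (k l L : nat) (H : {set {set V}}).
Variables (W : 'I_L -> {set V}) (G : {set {perm V}}) (Mf : {perm V} -> {set {set V}}).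
Hypotheses (uH : uniform k H) (k_gt0 : 0 < k).
Hypothesis W_le : forall i, #|W i| <= l.
Hypothesis W_deg : forall x, \sum_i (x \in W i) <= 2.
Hypothesis G_gt0 : 0 < #|G|.
Hypothesis G_spread : forall ps vs, uniq ps -> uniq vs -> size ps = size vs ->
  #|extends ps vs :&: G| * #|V| ^_ (size ps) <= 4 ^ size ps * #|G|.
Hypothesis Mf_opt : forall p, p \in G -> Mf p \in optimal_matchings k H.
Hypothesis Mf_window : forall p e, p \in G -> e \in Mf p -> exists i, e \subset p @: W i.


Local Open Scope ring_scope.

Definition pushforward (M : {set {set V}}) : R := #|[set p in G | Mf p == M]|%:R / #|G|%:R.

Lemma sum_pushforward (P : pred {set {set V}}) :
  \sum_(M | P M) pushforward M = #|[set p in G | P (Mf p)]|%:R / #|G|%:R.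
Proof.
rewrite -mulr_suml -natr_sum; congr (_%:R / _).
rewrite -sum1dep_card (partition_big Mf P) /= => [|p /andP[]//].
apply: eq_bigr => M PM; rewrite -sum1dep_card; apply: eq_bigl => p.
by case: eqP => [->|_]; rewrite ?PM ?andbT ?andbF.
Qed.

Lemma pushforward_probability : probability_on (optimal_matchings k H) pushforward.
Proof.
have G0 : #|G|%:R != 0 :> R by rewrite pnatr_eq0 -lt0n.
split=> [M|M MA|].
- by rewrite divr_ge0.
- rewrite /pushforward (_ : [set p in G | Mf p == M] = finset.set0) ?cards0 ?mul0r //.
  apply/setP => p; rewrite !inE; apply/negP => /andP[pG /eqP E].
  by move: MA; rewrite -E Mf_opt.
rewrite sum_pushforward (_ : [set p in G | _] = G) ?divff //.
by apply/setP => p; rewrite inE; case: (boolP (p \in G)) => //= /Mf_opt ->.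
Qed.

(** In [spread_count] the falling factorial is replaced by a power at the cost of one factor
    [expR 1] per vertex. Each edge then contributes [n (2l)^(k-1) (4e)^k / n^k], which is
    [C / n^(k-1)]. *)
Lemma pushforward_spread (C : R) : C = (2 * l)%:R ^+ k.-1 * (4 * expR 1) ^+ k ->
  C <= #|V|%:R ^+ k.-1 -> (0 < #|V|)%N ->
  spread H pushforward (C / #|V|%:R ^+ k.-1).
Proof.
move=> CE Cn n0; have nk0 : 0 < #|V|%:R ^+ k.-1 :> R by rewrite exprn_gt0 ?ltr0n.
have C0 : 0 <= C by rewrite CE mulr_ge0 ?exprn_ge0 // mulr_ge0 ?expR_ge0.
split; first by rewrite divr_ge0 ?(ltW nk0) //= ler_pdivrMr // mul1r.
move=> t E t1 EH Et; rewrite /prob sum_pushforward.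
have gR : 0 < #|G|%:R :> R by rewrite ltr0n.
have [tE|ntE] := boolP (trivIset E); last first.
  rewrite (_ : [set p in G | _] = finset.set0) ?cards0 ?mul0r.
    by rewrite exprn_ge0 // divr_ge0 // ltW.
  apply/setP => p; rewrite !inE; apply/negP => /andP[/Mf_opt + EM].
  rewrite inE => /andP[/andP[_ tM] _]; case/negP: ntE; exact: trivIsetS EM tM.
have Ek e : e \in E -> #|e| = k by move=> /(subsetP EH)/(forall_inP uH)/eqP.
have ktn : (k * t <= #|V|)%N.
  by rewrite -Et -(card_cover uH EH tE) max_card.
have := spread_count k_gt0 W_le W_deg G_spread Ek tE.
set A := [set p in G | [forall e in E, _]]; rewrite Et => cnt.
have : (#|[set p in G | E \subset Mf p]| <= #|A|)%N.
  apply/subset_leq_card/subsetP => p; rewrite !inE => /andP[pG EM]; rewrite pG /=.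
  apply/forall_inP => e /(subsetP EM)/(Mf_window pG)[i ei].
  by apply/existsP; exists i.
rewrite -(ler_nat R) => le1; rewrite ler_pdivrMr //; apply: le_trans le1 _.
have nkt : 0 < #|V|%:R ^+ (k * t) :> R by rewrite exprn_gt0 ?ltr0n.
rewrite -(ler_pM2l nkt).
apply: le_trans (ler_wpM2r (ler0n _ _) (exp_le_ffact R ktn)) _.
rewrite -mulrA [_%:R * #|A|%:R]mulrC -natrM.
move: cnt; rewrite -(ler_nat R) => cnt.
apply: le_trans (ler_wpM2l (exprn_ge0 _ (expR_ge0 _)) cnt) _.
by rewrite CE (spread_arith _ _ _ _ n0 k_gt0).
Qed.
End Measure.

Local Open Scope ring_scope.

Lemma ffactD n a b : (n ^_ (a + b) = n ^_ a * (n - a) ^_ b)%N.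
Proof.
elim: b => [|b IH]; first by rewrite addn0 ffactn0 muln1.
by rewrite addnS !ffactnSr IH subnDA mulnA.
Qed.

(** Replacing the normalisation ['C(n - d, k - d)] by [n^(k-d) / (k-d)!] has relative error at most
    [k^2/n <= gamma/8], and [mu + gamma <= 1] turns this into an absolute loss of [gamma/8]. *)
Lemma degree_condition (R : realType) (V : finType) (H : {set {set V}}) (d k : nat) (mu gamma : R)
  (S : {set V}) :
  (0 < d < k)%N -> 0 <= mu -> 0 < gamma -> mu + gamma <= 1 -> (0 < #|V|)%N ->
  (8 * (k * k))%:R <= gamma * #|V|%:R ->
  (mu + gamma) * 'C(#|V| - d, k - d)%:R <= (degree H S)%:R ->
  (mu + 7 / 8 * gamma) * #|V|%:R ^+ (k - d) <= ((k - d)`! * degree H S)%:R.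
Proof.
set n := #|V|; move=> /andP[d0 dk] mu0 g0 le1 n0 nk hdeg.
have n0R : 0 < n%:R :> R by rewrite ltr0n.
have f0 : 0 < (k - d)`!%:R :> R by rewrite ltr0n fact_gt0.
rewrite natrM; apply: le_trans (ler_wpM2l (ltW f0) hdeg).
rewrite mulrCA -natrM [((k - d)`! * _)%N]mulnC bin_ffact.
(* This is [ffact_ge] at [k.-1], with the first [d] factors of [n ^_ k] bounded by [n ^ d] and
   cancelled. *)
have low : (n ^ (k - d).-1 * (n - k.-1 * k.-1) <= (n - d) ^_ (k - d))%N.
  have nd0 : (0 < n ^ d)%N by rewrite expn_gt0 n0.
  rewrite -(leq_pmul2l nd0) mulnA -expnD.
  have -> : (d + (k - d).-1 = k.-1)%N by lia.
  apply: leq_trans (ffact_ge n k.-1) _.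
  have -> : (n * n.-1 ^_ k.-1 = n ^_ d * (n - d) ^_ (k - d))%N.
    by rewrite -ffactD -ffactnS; congr (_ ^_ _)%N; lia.
  by rewrite leq_mul2r ffact_le_expn orbT.
have up : n%:R ^+ (k - d) - (k * k)%:R * n%:R ^+ (k - d).-1 <= ((n - d) ^_ (k - d))%:R :> R.
  apply: (@le_trans _ _ (n ^ (k - d).-1 * (n - k.-1 * k.-1))%:R); last by rewrite ler_nat.
  have r0 : (0 < k - d)%N by rewrite subn_gt0.
  rewrite [X in _ <= X]natrM natrX -{1}(prednK r0) exprS -mulrBl [X in _ <= X]mulrC.
  rewrite ler_wpM2r ?exprn_ge0 // lerBlDr -natrD ler_nat.
  by have := leq_pred k; clear; nia.
have r1 : n%:R ^+ (k - d) = n%:R * n%:R ^+ (k - d).-1 :> R.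
  by rewrite -exprS prednK // subn_gt0.
have w0 : 0 <= n%:R ^+ (k - d).-1 :> R by rewrite exprn_ge0.
have k2 : 8 * (k * k)%:R <= gamma * n%:R by rewrite -natrM.
move: up; rewrite r1; set w := n%:R ^+ _ in w0 *; move: ((n - d) ^_ (k - d))%:R => F up.
have F0 : (n%:R - (k * k)%:R) * w <= F by rewrite mulrBl.
apply: le_trans (_ : (mu + gamma) * ((n%:R - (k * k)%:R) * w) <= _).
  rewrite !mulrA ler_wpM2r //; have : 0 <= (k * k)%:R :> R by [].
  nra.
by rewrite ler_wpM2l // addr_ge0 // ltW.
Qed.

Section RandomWindows.
Variables (R : realType) (V : finType) (H : {set {set V}}) (d k s m : nat) (mu gamma : R).
Let n := #|V|.
Let N := (k * k.*2)%N.
Let C : R := (2 * (4 * m))%:R ^+ k.-1 * (4 * expR 1) ^+ k.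
Let kappa : R := (gamma / 8) ^+ 2 / (8 * (k - d)%:R ^+ 2).
Hypotheses (dk : (0 < d < k)%N) (sk : (s < k)%N) (mu0 : 0 <= mu) (gamma0 : 0 < gamma).
Hypotheses (uH : uniform k H) (ns : (n %% k = s)%N).
Hypothesis hdeg : forall S : {set V}, #|S| = d ->
  (mu + gamma) * 'C(n - d, k - d)%:R <= (degree H S)%:R.
Hypotheses (m_gt : (d + N <= m)%N) (m_large1 : (4 * (N * k))%:R <= gamma * m%:R)
  (m_large2 : (4 * (k * k))%:R <= gamma * m%:R).
Hypothesis m_threshold : forall M, (m <= M + N)%N -> (M %% k = s)%N ->
  exists2 D, forces_optimal_matching d k M D & D%:R <= (mu + gamma / 4) * 'C(M - d, k - d)%:R.
Hypothesis m_tail : (128 * 4 ^ d)%:R * m%:R ^+ d.+1 <= expR (kappa * (m - d.+1)%:R).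
Hypotheses (n_large1 : (32 * (m * m) <= n)%N) (n_large2 : (8 * (k * k))%:R <= gamma * n%:R)
  (n_large3 : C <= n%:R ^+ k.-1).

Lemma spread_measure_exists : exists nu : {set {set V}} -> R,
  probability_on (optimal_matchings k H) nu /\ spread H nu (C / n%:R ^+ k.-1).
Proof.
have g0 := gamma0; have p0 := mu0.
have [d0 dk'] := andP dk; have k0 : (0 < k)%N by apply: ltn_trans dk'.
have r0 : (0 < k - d)%N by rewrite subn_gt0.
have NE : N = (2 * (k * k))%N by rewrite /N; clear; lia.
have km : (k < m)%N by clear -m_gt NE d0 k0; nia.
have m0 : (0 < m)%N by apply: leq_trans km.
have mn : (m <= n)%N by clear -n_large1 m0; nia.
have n0 : (0 < n)%N by apply: leq_trans mn.
have dn : (d <= n)%N by clear -dk' km mn; lia.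
have le1 : mu + gamma <= 1.
  have [S _ Sd] : exists2 S : {set V}, S \subset [set: V] & #|S| = d.
    by apply: exists_subset_card; rewrite cardsT.
  have := le_trans (hdeg Sd) (_ : _ <= 'C(n - d, k - d)%:R).
  rewrite ler_nat -{1}Sd -{1}Sd degree_le_bin // => /(_ isT).
  rewrite -[X in _ <= X]mul1r ler_pM2r // ltr0n bin_gt0 leq_sub2r //.
  by clear -km mn; lia.
have [l [b [l0 bl bsz]]] := exists_blocks (V := V) (m := m) ltac:(by rewrite m0 mn).
pose X (i : nat) : {set V} := [set x | b x == i].
pose W (i : nat) : {set V} := [set x | (b x == i) || ((b x).+1 == i)].
have XW i : X i \subset W i by apply/subsetP => x; rewrite !inE => ->.
have Xm i : (i < l)%N -> (m <= #|X i| <= 2 * m)%N by apply: bsz.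
have Wm i : (i < l)%N -> (#|W i| <= 4 * m)%N.
  move=> il; apply: (@leq_trans (#|X i| + #|X i.-1|)).
    apply: leq_trans (leq_card_setU _ _); apply/subset_leq_card/subsetP => x.
    by rewrite !inE => /orP[->//|/eqP <-]; rewrite eqxx orbT.
  have /andP[_ h1] := Xm _ il; have /andP[_ h2] := Xm _ (leq_ltn_trans (leq_pred i) il).
  by clear -h1 h2; lia.
(* The gap [gamma/4] from [rho - lambda] down to [q] pays for positions missing from the sample; the
   gap [gamma/4] from [q] down to the level of [m_threshold] pays for vertices lost from a block. *)
pose q := mu + gamma / 2; pose rho := mu + 7 / 8 * gamma; pose lambda := gamma / 8.
have lam : 0 < lambda <= 1 by rewrite /lambda; apply/andP; split; lra.
have hrho (S : {set V}) : #|S| = d -> rho * n%:R ^+ (k - d) <= ((k - d)`! * degree H S)%:R.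
  by move=> Sd; apply: degree_condition => //; apply: hdeg.
have mR : 0 < m%:R :> R by rewrite ltr0n.
have hq a c : (m <= c)%N -> (c - d.+1 <= a <= c)%N ->
    q * 'C(c, k - d)%:R <= (rho - lambda) * 'C(a, k - d)%:R.
  move=> mc /andP[ca ac]; have c0 := leq_trans m0 mc.
  have mcR : m%:R <= c%:R :> R by rewrite ler_nat.
  have sh := bin_shrink (R := R) (xi := gamma / 4) r0 ac c0.
  have {}sh : (1 - gamma / 4) * 'C(c, k - d)%:R <= 'C(a, k - d)%:R.
    apply: sh; rewrite mulrAC ler_pdivlMr // mulrC -natrM.
    apply: le_trans (ler_wpM2l (ltW gamma0) mcR); apply: le_trans m_large2.
    rewrite ler_nat leq_mul2l /= leq_mul ?leq_subr //.
    by clear -ca dk'; lia.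
  have rl : 0 <= rho - lambda by rewrite /rho /lambda; lra.
  apply: le_trans (ler_wpM2l rl sh); rewrite mulrA ler_wpM2r // /q /rho /lambda.
  by nra.
pose bad (i : 'I_l) (p : {perm V}) := poor H d k q (p @: W i) (p @: X i).
have W_deg x : (\sum_(i < l) (x \in W i) <= 2)%N.
  apply: leq_trans (leq_add (sum_eq_le1 l (b x)) (sum_eq_le1 l (b x).+1)).
  rewrite -big_split /=; apply: leq_sum => i _; rewrite inE.
  by case: (_ == _) => //; case: (_ == _).
have bad_local (i : 'I_l) (p p' : {perm V}) : {in W i, p =1 p'} -> bad i p = bad i p'.
  move=> E; rewrite /bad (eq_in_imset E); congr poor; apply: eq_in_imset => x xX.
  by apply: E; rewrite (subsetP (XW i)).
have bad_rare (i : 'I_l) x v : x \in W i ->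
    (16 * (4 * m) * #|[set p : {perm V} | (p x == v) && bad i p]| <= (#|V|.-1)`!)%N.
  move=> xW; have /andP[mX X2m] := Xm i (ltn_ord i); have W4 := Wm i (ltn_ord i).
  have rare := poor_rare uH dk lam hrho v (XW i) xW _ _ (fun a => hq a _ mX).
  rewrite -(ler_nat R) natrM.
  apply: le_trans (ler_wpM2l (ler0n _ _) (rare _ _)) _.
  - by apply: leq_trans n_large1; clear -W4; nia.
  - by rewrite subnKC ?(ltnW dk') // (leq_trans km).
  have f0 : 0 < (n.-1)`!%:R :> R by rewrite ltr0n fact_gt0.
  set t := tail d k lambda #|X i|.
  have kap0 : 0 <= kappa.
    apply: divr_ge0; last by rewrite mulr_ge0 ?exprn_ge0.
    by apply/exprn_ge0/divr_ge0 => //; apply: ltW.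
  have tle : t <= expR (- (kappa * (m - d.+1)%:R)).
    rewrite /t /tail ler_expR lerN2; apply: ler_wpM2l => //.
    by rewrite ler_nat leq_sub2r.
  have E : expR (- (kappa * (m - d.+1)%:R)) * expR (kappa * (m - d.+1)%:R) = 1.
    by rewrite -expRD addNr expR0.
  have tle2 : (128 * 4 ^ d)%:R * m%:R ^+ d.+1 * t <= 1.
    apply: le_trans (ler_wpM2l _ tle) _; first by rewrite mulr_ge0 ?exprn_ge0.
    by apply: le_trans (ler_wpM2r (expR_ge0 _) m_tail) _; rewrite mulrC E.
  have Wd : #|W i|%:R ^+ d <= (4 * m)%:R ^+ d :> R by rewrite lerXn2r ?nnegrE ?ler_nat.
  have t0 : 0 <= t by apply: expR_ge0.
  apply: (@le_trans _ _ ((16 * (4 * m))%:R * ((4 * m)%:R ^+ d * (2 * (n.-1)`!%:R * t)))).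
    by rewrite ler_wpM2l // ler_wpM2r // mulr_ge0 // mulr_ge0.
  rewrite -[X in _ <= X]mul1r -/n.
  (* The constant in [m_tail] is [16 * 4m * (4m)^d * 2 = 128 * 4^d * m^(d+1)]. *)
  rewrite (_ : _ * _ = (128 * 4 ^ d)%:R * m%:R ^+ d.+1 * t * (n.-1)`!%:R); first by rewrite ler_wpM2r.
  by rewrite !natrM natrX exprMn exprS; ring.
have W_le (i : 'I_l) : (#|W i| <= 4 * m)%N by apply: Wm.
have W_n0 (i : 'I_l) : W i != finset.set0.
  have /andP[mX _] := Xm i (ltn_ord i); rewrite -card_gt0.
  by apply: leq_trans (subset_leq_card (XW i)); apply: leq_trans mX.
have m4 : (0 < 4 * m)%N by rewrite muln_gt0.
pose G := all_good bad.
have G0 : (0 < #|G|)%N := all_good_gt0 m4 W_le W_n0 W_deg bad_local bad_rare.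
have Gs := all_good_spread m4 W_le W_deg bad_local bad_rare.
pose inside (p : {perm V}) (M : {set {set V}}) := [forall e in M, [exists i : 'I_l, (e : {set V}) \subset p @: W i]].
have exM p : p \in G -> exists2 M, M \in optimal_matchings k H & inside p M.
  rewrite inE => /forallP pG.
  (* Permutations send positions to vertices: a vertex belongs to the block of its preimage, so the
     blocks and windows of [f] are the images of [X i] and [W i]. *)
  pose f y := b ((p^-1)%g y).
  have imE (P : pred V) : p @: [set x | P x] = [set y | P ((p^-1)%g y)].
    apply/setP => y; rewrite inE; apply/imsetP/idP => [[x]|Py].
      by rewrite inE => Px ->; rewrite permK.
    by exists ((p^-1)%g y); rewrite ?inE ?permKV.
  have bE i : block f i = p @: X i by rewrite imE.
  have wE i : window f i = p @: W i by rewrite imE.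
  have cX i : #|p @: X i| = #|X i| by rewrite card_imset //; apply: perm_inj.
  have e1 : gamma / 4 < q by rewrite /q; lra.
  have fl y : (f y < l)%N by apply: bl.
  have rich_f i : (i < l)%N -> rich H d k q (window f i) (block f i).
    by move=> il; rewrite bE wE; apply/rich_not_poor/(pG (Ordinal il)).
  have large_f i : (i < l)%N -> large d k N (gamma / 4) (block f i).
    move=> il; have /andP[mX _] := Xm i il; rewrite bE; split; rewrite cX.
      exact: leq_trans mX.
    rewrite mulrAC ler_pdivlMr // mulrC -natrM; apply: le_trans m_large1 _.
    by rewrite ler_wpM2l ?ler_nat // ltW.
  have thr_f i (Y : {set V}) : (i < l)%N -> Y \subset block f i ->
      (#|block f i| <= #|Y| + N)%N -> (#|Y| %% k = s)%N ->
      exists2 D, forces_optimal_matching d k #|Y| D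
        & D%:R <= (q - gamma / 4) * 'C(#|block f i|, k - d)%:R.
    move=> il YX; have := subset_leq_card YX; rewrite bE cX => YX' XY Ys.
    have /andP[mX _] := Xm i il.
    have [D fD Dle] := m_threshold (leq_trans mX XY) Ys; exists D => //.
    apply: le_trans Dle _; rewrite (_ : q - gamma / 4 = mu + gamma / 4); last by rewrite /q; lra.
    rewrite ler_wpM2l; [by []|by lra|].
    by rewrite ler_nat leq_bin2l // (leq_trans (leq_subr _ _)).
  have [M MO Mw] := chain_matching uH dk sk e1 l0 fl ns (leqnn N) rich_f large_f thr_f.
  exists M => //; apply/forall_inP => e /Mw[i il ei]; apply/existsP.
  by exists (Ordinal il); rewrite -wE.
pose Mf p := odflt finset.set0 [pick M in optimal_matchings k H | inside p M].
have MfP p : p \in G -> Mf p \in optimal_matchings k H /\ inside p (Mf p).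
  move=> /exM[M MO Mi]; rewrite /Mf; case: pickP => [M' /andP[//]|/(_ M)].
  by rewrite MO Mi.
exists (pushforward R G Mf); split.
  by apply: pushforward_probability => // p /MfP[].
apply: (pushforward_spread uH k0 W_le W_deg G0 Gs) => //; first by move=> p /MfP[].
move=> p e /MfP[_ /forall_inP h] /h /existsP[i ei]; by exists i.
Qed.
End RandomWindows.

Lemma bound_le (R : realType) (A gamma : R) m : 0 <= A -> 0 < gamma ->
  (Num.bound (A / gamma) <= m)%N -> A <= gamma * m%:R.
Proof.
move=> A0 g0 hm; rewrite mulrC -ler_pdivrMr //.
apply: le_trans (_ : (Num.bound (A / gamma))%:R <= _); last by rewrite ler_nat.
by apply/ltW/archi_boundP/divr_ge0 => //; apply: ltW.
Qed.

Theorem theorem1p5 (R : realType) (d k s : nat)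
  (hk : (3 <= k)%N) (hd : (1 <= d <= k - 1)%N) (hs : (0 <= s <= k - 1)%N)
  (gamma : R) (hgamma : 0 < gamma) :
  exists (C : R) (n0 : nat), 0 < C /\
    forall n : nat, (exists j : nat, n = (k * j + s)%N) -> (n0 <= n)%N ->
    forall (V : finType) (H : {set {set V}}),
      #|V| = n -> uniform k H ->
      (mu_bar R d k s + gamma) * 'C(n - d, k - d)%:R <= (min_degree d H)%:R ->
      exists nu : {set {set V}} -> R,
        probability_on (optimal_matchings k H) nu /\
        spread H nu (C / n%:R ^+ (k - 1)).
Proof.
have k0 : (0 < k)%N by apply: leq_trans hk.
have dk : (0 < d < k)%N by clear -hd k0; lia.
have sk : (s < k)%N by clear -hs k0; lia.
have g4 : 0 < gamma / 4 by lra.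
have [M0 hM0] := optimal_threshold_eventually dk sk g4.
pose N := (k * k.*2)%N.
pose kappa : R := (gamma / 8) ^+ 2 / (8 * (k - d)%:R ^+ 2).
have kap0 : 0 < kappa.
  apply: divr_gt0; first by apply/exprn_gt0/divr_gt0.
  by rewrite mulr_gt0 // exprn_gt0 // ltr0n subn_gt0; case/andP: dk.
have [m1 hm1] := natpow_le_expR (A := (128 * 4 ^ d)%:R) d.+1 d.+1 kap0 (ler0n _ _).
pose m2 := Num.bound ((4 * (N * k))%:R / gamma).
pose m3 := Num.bound ((4 * (k * k))%:R / gamma).
(* The block size is fixed before [n]; as a sum it dominates every bound required of it. *)
pose m := (m1 + (M0 + N) + (d + N) + m2 + m3)%N.
have [mm1 mm0 mmd mm2 mm3] : [/\ (m1 <= m)%N, (M0 + N <= m)%N, (d + N <= m)%N, (m2 <= m)%N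
  & (m3 <= m)%N] by rewrite /m; clear; split; lia.
pose C : R := (2 * (4 * m))%:R ^+ k.-1 * (4 * expR 1) ^+ k.
have m0 : (0 < m)%N.
  by apply: leq_trans mmd; clear -hd; lia.
have C0 : 0 < C.
  by rewrite mulr_gt0 ?exprn_gt0 ?ltr0n ?muln_gt0 // mulr_gt0 ?expR_gt0.
(* Windows have at most [4m] positions, and [2 (4m)^2 = 32 m^2] serves the comparison with
   independent samples. The other two bounds serve [degree_condition] and make [C / n^(k-1)] at most
   1. *)
exists C, (maxn (32 * (m * m)) (maxn (Num.bound ((8 * (k * k))%:R / gamma)) (Num.bound C))).
split=> // n [j nE] + V H Vn uH; rewrite -Vn subn1 !geq_max => /and3P[n1 n2 n3] hmin.
have ns : (#|V| %% k = s)%N by rewrite Vn nE mulnC modnMDl modn_small.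
apply: (@spread_measure_exists R V H d k s m (mu_bar R d k s) gamma dk sk (mu_bar_ge0 R dk sk) hgamma uH ns).
- move=> S Sd; apply: le_trans hmin _; rewrite ler_nat; exact: min_degree_le.
- exact: mmd.
- exact: bound_le.
- exact: bound_le.
- by move=> M mM; apply: hM0; rewrite -(leq_add2r N) (leq_trans mm0).
- exact: hm1.
- exact: n1.
- exact: bound_le.
apply: (@le_trans _ _ #|V|%:R).
  apply: le_trans (_ : (Num.bound C)%:R <= _); last by rewrite ler_nat.
  by apply/ltW/archi_boundP/ltW.
rewrite -natrX ler_nat -[X in (X <= _)%N]expn1 leq_pexp2l //.
  by apply: leq_trans n1; rewrite !muln_gt0 m0.
by clear -hk; lia.
Qed.
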